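(* Let $V$ be a JB-algebra, let $k\in\mathrm{Aut}(V)$ and let $D\in\mathrm{Der}(V)$ be such that $\|D\|<\pi/2$. Consider the geodesic $\delta(t)=ke^{tD}$, $t\in[0,1]$. Then $\delta$ is minimizing in $\mathrm{Aut}(V)$, i.e. $$\mathrm{dist}_{\mathrm{Aut}(V)}(k,ke^D)=\|D\|=\mathrm{Length}(\delta).$$ Moreover, if $\gamma\subset\mathrm{Aut}(V)$ is any piecewise $C^1$ path joining $k$ and $ke^D$ such that $\mathrm{Length}(\gamma)=\|D\|$, then for any unit norm functional $\varphi\in\mathrm{Der}(V)^*$ such that $\varphi(D)=\|D\|$, we have that $\gamma_t^{-1}\gamma_t'$ sits inside the same face of the sphere $F_\varphi=\varphi^{-1}(\|D\|)$ for all $t$. In particular, if the norm is smooth at $D$, then the unique geodesic is $\delta$.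
   Context: A JB-algebra is a real Banach space $V$ with a bilinear commutative product $\circ$ and unit $1$ such that $x^2\circ(x\circ y)=x\circ(x^2\circ y)$, $\|x\circ y\|\le\|x\|\|y\|$, $\|x^2\|=\|x\|^2$ and $\|x^2\|\le\|x^2+y^2\|$. $B(V)$ is the algebra of bounded operators on $V$ with operator norm $\|\cdot\|$. $\mathrm{Aut}(V)$ is the group of invertible $k\in B(V)$ with $k(1)=1$ and $k(a\circ b)=k(a)\circ k(b)$; it is an embedded Banach-Lie subgroup of the invertible operators, with Lie algebra $\mathrm{Der}(V)=\{D\in B(V):D(x\circ y)=Dx\circ y+x\circ Dy\}$, normed by the operator norm. $\mathrm{Aut}(V)$ carries the left-invariant connection with quadratic spray $F_g(gD)=gD^2$, $g\in\mathrm{Aut}(V)$, $D\in\mathrm{Der}(V)$, whose geodesics are the paths $t\mapsto ke^{tD}$. Its Finsler norm is $\|H\|_g=\|g^{-1}H\|$ for $H\in T_g\mathrm{Aut}(V)=g\,\mathrm{Der}(V)$. $\mathrm{Length}(\gamma)=\int\|\gamma_t^{-1}\gamma_t'\|\,dt$ for piecewise $C^1$ paths, and $\mathrm{dist}_{\mathrm{Aut}(V)}$ is the infimum of lengths of piecewise $C^1$ paths in $\mathrm{Aut}(V)$ joining the given points. The norm is smooth at $D$ if there is only one unit norm functional $\varphi\in\mathrm{Der}(V)^*$ with $\varphi(D)=\|D\|$.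
   Formalization: The velocity of a short path is shown to lie in the face F_φ when the path has constant speed on [0,1], and in the cone over F_φ in general (k e^{t²D} violates the literal claim); uniqueness of δ is among geodesics ke^{tX} of length ‖D‖ joining k and ke^D. *)

(* Defs.v *)
From HB Require Import structures.
From mathcomp Require Import all_boot all_order all_algebra.
From mathcomp Require Import all_classical all_reals all_analysis.

Set Implicit Arguments.
Unset Strict Implicit.
Unset Printing Implicit Defensive.

Import Order.TTheory GRing.Theory Num.Theory.
Import numFieldNormedType.Exports.

Local Open Scope classical_set_scope.
Local Open Scope ring_scope.

Section BoundedLinearMaps.
Context {R : realType} (E F : normedModType R).

Definition is_blin (f : E -> F) : Prop :=
  linear f /\ exists M : R, forall x, `|f x| <= M * `|x|.

Definition blin_pred : {pred E -> F} := fun f => `[< is_blin f >].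

Fact blin_submod_closed : submod_closed blin_pred.
Proof.
split=> [|a f g /asboolP[fl [M fM]] /asboolP[gl [N gN]]]; apply/asboolP.
  split; first by move=> a x y /=; rewrite scaler0 addr0.
  by exists 0 => x; rewrite normr0 mul0r.
split.
  move=> b x y; rewrite !fctE fl gl !scalerDr !scalerA (mulrC a b) -!addrA.
  by congr (_ + _); rewrite addrCA.
exists (`|a| * M + N) => x; rewrite !fctE (le_trans (ler_normD _ _))//.
by rewrite mulrDl lerD// normrZ -mulrA ler_wpM2l.
Qed.

HB.instance Definition _ :=
  GRing.isSubmodClosed.Build R (E -> F) blin_pred blin_submod_closed.

Record blin : Type :=
  BLin { blin_fun :> E -> F ; blin_funP : blin_fun \in blin_pred }.

HB.instance Definition _ := [isSub for blin_fun].
HB.instance Definition _ := [Choice of blin by <:].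
HB.instance Definition _ := [SubChoice_isSubLmodule of blin by <:].

Definition opnorm (f : blin) : R := sup [set `|f x| | x in [set x | `|x| <= 1]].

Lemma blinP (f g : blin) : (forall x, f x = g x) -> f = g.
Proof. by move=> fg; apply/val_inj/funext. Qed.

Lemma blin_scaleDE a (f g : blin) x : (a *: f + g) x = a *: f x + g x.
Proof. by []. Qed.

Lemma blin_linear (f : blin) : linear f.
Proof. by have /asboolP[] := blin_funP f. Qed.

Lemma blin_bounded (f : blin) : exists M : R, forall x, `|f x| <= M * `|x|.
Proof. by have /asboolP[] := blin_funP f. Qed.

Lemma blinZ (f : blin) a x : f (a *: x) = a *: f x.
Proof.
have f0 : f 0 = 0.
  by have := blin_linear f (-1) 0 0; rewrite scaler0 addr0 scaleN1r addNr.
by have := blin_linear f a x 0; rewrite !addr0 f0 addr0.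
Qed.

Lemma blin0 (f : blin) : f 0 = 0.
Proof. by have := blinZ f 0 0; rewrite !scale0r. Qed.

Lemma opnorm_has_sup (f : blin) :
  has_sup [set `|f x| | x in [set x | `|x| <= 1]].
Proof.
split; first by exists `|f 0|, 0 => //=; rewrite normr0.
have [M fM] := blin_bounded f; exists `|M| => _ [x /= x1 <-].
apply: le_trans (fM x) _; apply: le_trans (ler_norm _) _.
by rewrite normrM normr_id ler_piMr.
Qed.

Lemma opnorm_ge0 (f : blin) : 0 <= opnorm f.
Proof.
apply: le_trans (normr_ge0 (f 0)) _.
by apply: (sup_upper_bound (opnorm_has_sup f)); exists 0 => //=; rewrite normr0.
Qed.

Lemma ler_opnorm (f : blin) x : `|f x| <= opnorm f * `|x|.
Proof.
have [->|x0] := eqVneq x 0; first by rewrite blin0 !normr0 mulr0.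
have x_gt0 : 0 < `|x| by rewrite normr_gt0.
rewrite -ler_pdivrMr// mulrC -[X in X * _]ger0_norm ?invr_ge0//.
rewrite -normrZ -blinZ; apply: (sup_upper_bound (opnorm_has_sup f)).
by eexists; last reflexivity; rewrite /= normrZ ger0_norm ?invr_ge0// mulVf ?gt_eqF.
Qed.

Lemma opnorm_le (f : blin) M :
  (forall x, `|x| <= 1 -> `|f x| <= M) -> opnorm f <= M.
Proof.
by move=> fM; apply: ge_sup;
  [case: (opnorm_has_sup f)|move=> _ [x /= x1 <-]; exact: fM].
Qed.

Fact opnormD (f g : blin) : opnorm (f + g) <= opnorm f + opnorm g.
Proof.
apply: opnorm_le => x x1; apply: le_trans (ler_normD _ _) _.
by rewrite lerD// (le_trans (ler_opnorm _ _))// ler_piMr// opnorm_ge0.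
Qed.

Fact opnormZ_le a (f : blin) : opnorm (a *: f) <= `|a| * opnorm f.
Proof.
apply: opnorm_le => x x1; rewrite /= fctE normrZ ler_wpM2l//.
by rewrite (le_trans (ler_opnorm _ _))// ler_piMr// opnorm_ge0.
Qed.

Fact opnormZ a (f : blin) : opnorm (a *: f) = `|a| * opnorm f.
Proof.
apply/eqP; rewrite eq_le opnormZ_le/=.
have [->|a0] := eqVneq a 0; first by rewrite normr0 mul0r opnorm_ge0.
rewrite -ler_pdivlMl ?normr_gt0// -normfV -{1}[f](scalerK a0).
by rewrite opnormZ_le.
Qed.

Fact opnorm0_eq0 (f : blin) : opnorm f = 0 -> f = 0.
Proof.
move=> f0; apply: blinP => x; apply/eqP; rewrite -normr_le0.
by rewrite (le_trans (ler_opnorm _ _))// f0 mul0r.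
Qed.

HB.instance Definition _ :=
  Lmodule_isNormed.Build R blin opnormD opnormZ opnorm0_eq0.

End BoundedLinearMaps.

Section Operators.
Context {R : realType} (E : normedModType R).

Fact bcomp_subproof (f g : blin E E) : f \o g \in @blin_pred R E E.
Proof.
apply/asboolP; split; first by move=> a x y /=; rewrite !blin_linear.
exists (opnorm f * opnorm g) => x /=; rewrite -mulrA.
by rewrite (le_trans (ler_opnorm _ _))// ler_wpM2l ?opnorm_ge0 ?ler_opnorm.
Qed.

Definition bcomp (f g : blin E E) : blin E E := BLin (bcomp_subproof f g).

Fact bid_subproof : id \in @blin_pred R E E.
Proof. by apply/asboolP; split=> //; exists 1 => x; rewrite mul1r. Qed.

Definition bid : blin E E := BLin bid_subproof.

Definition inverse_of (f g : blin E E) : Prop :=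
  bcomp f g = bid /\ bcomp g f = bid.

(* The inverse operator; it is 0 when [f] is not invertible. *)
Definition binv (f : blin E E) : blin E E := xget 0 [set g | inverse_of f g].

Definition bexp (f : blin E E) : blin E E :=
  lim (series (fun n => n`!%:R^-1 *: iter n (bcomp f) bid) @ \oo).

End Operators.

HB.mixin Record CompleteNormedModule_isJBAlgebra (R : realType) V
    & CompleteNormedModule R V := {
  jone : V ;
  jmul : V -> V -> V ;
  jmulC : commutative jmul ;
  jmul1 : left_id jone jmul ;
  jmul_linear : forall z, linear (jmul z) ;
  jordan_identity : forall x y,
    jmul (jmul x x) (jmul x y) = jmul x (jmul (jmul x x) y) ;
  jnormM : forall x y, `|jmul x y| <= `|x| * `|y| ;
  jnorm_sqr : forall x, `|jmul x x| = `|x| ^+ 2 ;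
  jnorm_sqrD : forall x y, `|jmul x x| <= `|jmul x x + jmul y y|
}.

#[short(type="jbAlgebraType")]
HB.structure Definition JBAlgebra (R : realType) :=
  {V of CompleteNormedModule R V & CompleteNormedModule_isJBAlgebra R V}.

Section AutDer.
Context {R : realType} (V : jbAlgebraType R).

Definition Aut : set (blin V V) := [set k |
  [/\ exists h, inverse_of k h, k jone = jone
    & forall a b, k (jmul a b) = jmul (k a) (k b)] ].

Definition derivation_pred : {pred blin V V} := fun D =>
  `[< forall x y, D (jmul x y) = jmul (D x) y + jmul x (D y) >].

Fact derivation_submod_closed : submod_closed derivation_pred.
Proof.
have jr (z : V) : linear (jmul^~ z).
  by move=> a x y; rewrite !(jmulC _ z) jmul_linear.
split=> [|a f g /asboolP fD /asboolP gD]; apply/asboolP => x y.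
  rewrite /=.
  have := jmul_linear x (-1) 0 0; rewrite scaler0 addr0 scaleN1r addNr => ->.
  have := jr y (-1) 0 0; rewrite scaler0 addr0 scaleN1r addNr => ->.
  by rewrite addr0.
rewrite !blin_scaleDE fD gD [jmul (a *: f x + g x) y]jr jmul_linear scalerDr.
by rewrite -!addrA; congr (_ + _); rewrite addrCA.
Qed.

HB.instance Definition _ := GRing.isSubmodClosed.Build R (blin V V)
  derivation_pred derivation_submod_closed.

(* Der(V), as a normed space of its own so that its dual makes sense. *)
Record der : Type :=
  Der { der_op :> blin V V ; der_opP : der_op \in derivation_pred }.

HB.instance Definition _ := [isSub for der_op].
HB.instance Definition _ := [Choice of der by <:].
HB.instance Definition _ := [SubChoice_isSubLmodule of der by <:].

Definition der_norm (D : der) : R := `|der_op D|.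

Fact der_normD (D D' : der) : der_norm (D + D') <= der_norm D + der_norm D'.
Proof. exact: ler_normD. Qed.

Fact der_normZ a (D : der) : der_norm (a *: D) = `|a| * der_norm D.
Proof. exact: normrZ. Qed.

Fact der_norm0_eq0 (D : der) : der_norm D = 0 -> D = 0.
Proof. by move=> /normr0_eq0 D0; exact: val_inj. Qed.

HB.instance Definition _ :=
  Lmodule_isNormed.Build R der der_normD der_normZ der_norm0_eq0.

End AutDer.

Arguments Aut {R} V _.

Section Norming.
Context {R : realType} (E : normedModType R).

Definition dual := blin E R^o.

Definition norming (x : E) (phi : dual) : Prop :=
  `|phi| = 1 /\ phi x = `|x|.

Definition smooth_at (x : E) : Prop := exists! phi : dual, norming x phi.

(* The face cut out by [phi] on the sphere of radius [r]. *)
Definition face (phi : dual) (r : R) : set E :=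
  [set x | `|x| = r /\ phi x = r].

End Norming.

(* A path is parametrized by [0, 1] and represented by a function on R, whose
   values outside [0, 1] are irrelevant. *)

Section Paths.
Context {R : realType} (V : jbAlgebraType R).
Implicit Types (gamma : R -> blin V V) (g h : blin V V).

(* C^1 on the closed interval [a, b] for a path that is continuous there: the
   derivative exists inside and extends continuously to [a, b]. *)
Definition C1_on gamma (a b : R) : Prop :=
  exists2 w : R -> blin V V, {within `[a, b], continuous w}
    & forall t : R, t \in `]a, b[ -> is_derive t 1 gamma (w t).

Definition piecewise_C1 gamma : Prop :=
  {within `[0, 1], continuous gamma} /\
  exists2 s : seq R, itv_partition 0 1 s &
    forall i, (i < size s)%N ->
      C1_on gamma (nth 1 (0 :: s) i) (nth 1 (0 :: s) i.+1).

Definition Aut_path g h gamma : Prop :=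
  [/\ forall t : R, t \in `[0, 1] -> Aut V (gamma t), piecewise_C1 gamma,
      gamma 0 = g & gamma 1 = h].

(* [w] is a one-sided derivative at [t] of the path [gamma] on [0, 1]. *)
Definition velocity gamma (t : R) (w : blin V V) : Prop :=
  let q := fun u : R => u^-1 *: (gamma (u + t) - gamma t) in
  (t < 1 /\ q @ 0^'+ --> w) \/ (0 < t /\ q @ 0^'- --> w).

Definition finsler g (H : blin V V) : R := `|bcomp (binv g) H|.

(* The integrand is meaningless at the finitely many break points and at the
   endpoints, which are negligible. *)
Definition Length gamma : \bar R :=
  (\int[lebesgue_measure]_(t in `[0%R, 1%R])
     (finsler (gamma t) (derive1 gamma t))%:E)%E.

(* Extended-real valued: it is +oo when no path joins [g] and [h]. *)
Definition dist_Aut g h : \bar R :=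
  ereal_inf [set Length gamma | gamma in [set gamma | Aut_path g h gamma]].

Definition constant_speed gamma : Prop :=
  exists c : R, forall t w, t \in `[0, 1] -> velocity gamma t w ->
    finsler (gamma t) w = c.

(* The quadratic spray F_g(gD) = g D^2, with D = g^-1 H. *)
Definition spray g (H : blin V V) : blin V V :=
  let D := bcomp (binv g) H in bcomp g (bcomp D D).

(* Geodesics of the spray: solutions in Aut(V) of gamma'' = F_gamma(gamma'). *)
Definition geodesic gamma : Prop :=
  [/\ {within `[0, 1], continuous gamma},
      forall t : R, t \in `[0, 1] -> Aut V (gamma t)
    & forall t : R, t \in `]0, 1[ ->
        [/\ derivable gamma t 1,
            exists D : der V, derive1 gamma t = bcomp (gamma t) D
          & is_derive t 1 (derive1 gamma) (spray (gamma t) (derive1 gamma t))] ].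

Definition exp_path (k : blin V V) (D : der V) : R -> blin V V :=
  fun t => bcomp k (bexp (t *: (D : blin V V))).

End Paths.

(* Main.v *)
Require Import Defs.
From HB Require Import structures.
From mathcomp Require Import all_boot all_order all_algebra.
From mathcomp Require Import all_classical all_reals all_analysis measurable_realfun.
From mathcomp Require Import ring lra.

(** Automorphisms of a JB-algebra are isometries, so the group acts by isometries and
    the flow of a derivation is a one-parameter group of isometries. The proof
    measures a path of automorphisms through the angles [arcsin (f (gamma_t x))], where
    [x] is a vector and [f] a functional, both of norm at most 1.

    The engine is the Bernstein-Szego inequality: a real function [h] bounded by 1 on
    the line and of exponential type [s] satisfies [h'^2 <= s^2 (1 - h^2)]. Applied to
    [h t = f (e^{tX} x)] it gives [f (X x)^2 <= |X|^2 (1 - f (x)^2)] for the generator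
    [X] of a group of isometries ([flow_rate]). Hence the angle of [f (gamma_t x)]
    never moves faster than the Finsler speed of [gamma] ([path_angle]). On the other
    hand, if [f (D x)] is almost [|D|] then [f (e^{tD} x)] is almost [sin (t |D|)], again
    by Bernstein-Szego, so that for [|D| < pi / 2] the angle grows by almost [|D|]
    between 1 and [e^D] ([sharp_angle]). Thus no path from [k] to [k e^D] is shorter
    than [|D|], the length of [t |-> k e^{tD}].

    For a path [gamma] of length [|D|] there is no room left. Cut it at [a < b] and put
    [Q = gamma_a^-1 gamma_b]. One can reach [e^D] by going to [Q] first and then using up
    the rest of the length ([path_complement_angle]). So, if [f (D x)] is almost [|D|],
    then [f (Q x)] is almost [sin l], [l] being the length of [gamma] between [a] and
    [b]. A functional [phi] on the derivations that norms [D] inherits this from the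
    elementary functionals [f (_ x)] by differentiating the norm at [D]
    ([norming_ge]), and letting [b] tend to [a] shows that [phi] norms the velocity
    [gamma^-1 gamma'] as well ([norming_velocity]): the velocity lies in the cone over
    the face cut out by [phi].

    Finally a geodesic has constant velocity [X], hence equals [k e^{tX}], and its length
    is [|X|]. When this length is [|D|] and [e^X = e^D], then [X = D]: otherwise the
    coefficients of the closed path [e^{tX} e^{-tD}] would have a critical point, which
    Bernstein-Szego excludes as [|X| + |D| < pi] ([exp_injective]). *)

Set Implicit Arguments.
Unset Strict Implicit.
Unset Printing Implicit Defensive.

Import Order.TTheory GRing.Theory Num.Theory.
Import numFieldNormedType.Exports.

Local Open Scope classical_set_scope.
Local Open Scope ring_scope.

(** * The Bernstein-Szego inequality *)

Section BernsteinSzego.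
Context {R : realType}.
Implicit Types (F : R -> R) (h : nat -> R -> R).

(** The supremum of [F] need not be attained, but that of [F] minus a small
    parabola centred at [t0] is, and there the slope of [F] is that of the
    parabola. *)
Lemma almost_max (F dF : R -> R) (B d t0 : R) :
  (forall t : R, is_derive t 1 F (dF t)) -> (forall t, `|F t| <= B) -> 0 < d ->
  exists2 T, F t0 <= F T & `|dF T| <= d.
Proof.
move=> FdF FB d0.
have B0 : 0 <= B := le_trans (normr_ge0 _) (FB t0).
(* At distance [L] the parabola exceeds the oscillation of [F], and its slope is at
   most [d] up to there. *)
pose c := d ^+ 2 / (8 * (B + 1)); have B1 : 0 < 8 * (B + 1) by lra.
have c0 : 0 < c by rewrite divr_gt0// exprn_gt0.
pose L := d / (2 * c).
have L0 : 0 < L by rewrite divr_gt0// mulr_gt0.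
have cL : c * L ^+ 2 = 2 * B + 2.
  by rewrite /L /c; field; rewrite !gt_eqF//; lra.
pose G t := F t - c * (t - t0) ^+ 2.
have GdG (t : R) : is_derive t 1 G (dF t - c * (2 * (t - t0))).
  rewrite /G; have := FdF t => ?; apply: is_deriveB.
  apply: is_derive_eq; rewrite /GRing.scale/=; ring.
have [||T TL TG] := @EVT_max _ G (t0 - L) (t0 + L).
- lra.
- by apply: derivable_within_continuous => x _; have [] := GdG x.
have Gt0 : F t0 <= G T.
  have -> : F t0 = G t0 by rewrite /G subrr expr0n/= mulr0 subr0.
  by apply: TG; rewrite in_itv/=; lra.
have := FB t0; have := FB T; rewrite !ler_norml => /andP[_ FT] /andP[Ft0 _].
have cT : c * (T - t0) ^+ 2 <= 2 * B by move: Gt0; rewrite /G; lra.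
have TtL : `|T - t0| < L.
  rewrite -(@ltr_pXn2r _ 2) ?nnegrE ?(ltW L0) // real_normK ?num_real//.
  by rewrite -(ltr_pM2l c0) cL; lra.
exists T.
  by move: Gt0; rewrite /G; have := mulr_ge0 (ltW c0) (sqr_ge0 (T - t0)); lra.
have TI : T \in `]t0 - L, t0 + L[.
  by move: TtL; rewrite in_itv/= ltr_norml; lra.
have [||t tI| _ G0] := @derive1_at_max _ G (t0 - L) (t0 + L) T _ _ TI.
- lra.
- by move=> t _; have [] := GdG t.
- by apply: TG; move: tI; rewrite !in_itv/=; lra.
have [_ GT] := GdG T; move: G0; rewrite GT => /eqP; rewrite subr_eq0 => /eqP ->.
have -> : d = c * (2 * L) by rewrite /L; field; rewrite gt_eqF.
by rewrite normrM gtr0_norm// (ler_wpM2l (ltW c0))// normrM ger0_norm// (ler_wpM2l _ (ltW TtL)).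
Qed.

(** The derivatives of [h 0] are the [h n]. Up to scaling these are the restrictions
    to the line of the entire functions of exponential type 1 that are real and
    bounded by 1 on the line; the bounds on all derivatives stand for the growth
    condition in the complex plane. *)
Definition contractive_jet h :=
  forall n (t : R), is_derive t 1 (h n) (h n.+1 t) /\ `|h n t| <= 1.

Lemma contractive_jetS h : contractive_jet h -> contractive_jet (fun n => h n.+1).
Proof. by move=> hh n t; exact: hh. Qed.

(** The derivative of [F = m h_0^2 + h_1^2] is [2 h_1 (m h_0 + h_2)]. Where it almost
    vanishes either [h_1] is small, and [F <= m] because [|h_0| <= 1], or [m h_0]
    is close to [- h_2], and [F <= m] by the assumption on [h_2]. By [almost_max]
    the values of [F] at such points bound [F] everywhere. *)
Lemma energy_max (m : R) h t0 : contractive_jet h -> 1 <= m ->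
  (forall t, h 2 t ^+ 2 <= m * (m - h 1 t ^+ 2)) ->
  m * h 0 t0 ^+ 2 + h 1 t0 ^+ 2 <= m.
Proof.
move=> hh m1 h2m; have m0 : 0 < m by lra.
have hsq n t : 0 <= h n t ^+ 2 <= 1.
  by rewrite sqr_ge0/= -real_normK ?num_real// expr_le1//; have [] := hh n t.
apply/ler_addgt0Pr => d d0; pose e := Num.min 1 (d / 3).
have e0 : 0 < e by rewrite lt_min ltr01 divr_gt0.
have e1 : e <= 1 by rewrite ge_min lexx.
have ed : 3 * e <= d.
  have : e <= d / 3 by rewrite ge_min lexx orbT.
  lra.
pose F t := m * h 0 t ^+ 2 + h 1 t ^+ 2.
have FdF (t : R) : is_derive t 1 F (2 * (h 1 t * (m * h 0 t + h 2 t))).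
  have [h0' _] := hh 0 t; have [h1' _] := hh 1 t.
  rewrite /F; apply: is_derive_eq; rewrite /GRing.scale/=; ring.
have FB t : `|F t| <= m + 1.
  have /andP[a0 a1] := hsq 0%N t; have /andP[b0 b1] := hsq 1%N t.
  rewrite ger0_norm/F; first by rewrite lerD// ler_piMr// ltW.
  by rewrite addr_ge0// mulr_ge0// ltW.
have ee0 : 0 < 2 * e ^+ 2 by rewrite mulr_gt0// exprn_gt0.
have [T FT dFT] := almost_max t0 FdF FB ee0.
apply: (le_trans FT); rewrite /F.
have /andP[a0 a1] := hsq 0%N T; have /andP[b0 b1] := hsq 1%N T.
have {dFT} : `|h 1 T| <= e \/ `|m * h 0 T + h 2 T| <= e.
  have [|h1e] := leP `|h 1 T| e; [by left|right].
  rewrite leNgt; apply/negP => he; move: dFT; apply/negP; rewrite -ltNge.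
  rewrite normrM ger0_norm// ltr_pM2l// normrM expr2.
  by rewrite ltr_pM// ltW.
case=> [h1e|].
  have : h 1 T ^+ 2 <= e ^+ 2.
    by rewrite -real_normK ?num_real// lerXn2r// nnegrE ltW.
  have : e ^+ 2 <= e by rewrite expr2 ger_pMl.
  have : m * h 0 T ^+ 2 <= m by rewrite ger_pMr.
  lra.
rewrite ler_norml => /andP[xe ex].
have [_] := hh 2 T; rewrite ler_norml => /andP[ye ey].
have x2 : (m * h 0 T) ^+ 2 <= h 2 T ^+ 2 + 3 * e by nra.
have := h2m T; move: (h 2 T ^+ 2) x2 => y2 x2 y2m.
rewrite -(ler_pM2l m0).
have : 3 * e <= m * d by nra.
nra.
Qed.

(** The bound with constant [1 + c], applied to the derivative of the jet, is stronger
    than the hypothesis of [energy_max] for [m = 1 + c / 2], as [m ^+ 2 >= 1 + c].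
    Hence the excess over 1 can be halved again and again; for [m = 2] the
    hypothesis of [energy_max] is just [|h_2| <= 1]. *)
Lemma energy_bound n h t : contractive_jet h ->
  (1 + 2^-1 ^+ n) * h 0 t ^+ 2 + h 1 t ^+ 2 <= 1 + 2^-1 ^+ n.
Proof.
elim: n h t => [|n IH] h t hh.
  apply: (energy_max _ hh) => [|s]; rewrite expr0; first lra.
  by have [_] := hh 2 s; have [_] := hh 1 s; rewrite !ler_norml; nra.
apply: (energy_max _ hh) => [|s]; first by rewrite lerDl exprn_ge0.
have /= := IH _ s (contractive_jetS hh); rewrite (exprS _ n).
have : 0 <= h 1 s ^+ 2 by exact: sqr_ge0.
have : h 1 s ^+ 2 <= 1.
  by rewrite -real_normK ?num_real// expr_le1//; have [] := hh 1%N s.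
have : 0 <= (2^-1 : R) ^+ n by rewrite exprn_ge0.
move: (h 1 s ^+ 2) (h 2 s ^+ 2) ((2^-1 : R) ^+ n) => a b c c0 a1 a0 ab.
rewrite (le_trans (_ : b <= (1 + c) * (1 - a)))//; first lra.
by have := mulr_ge0 c0 a0; have := sqr_ge0 c; nra.
Qed.

(** In other words [arcsin h_0] has derivative at most 1: nothing bounded by 1 and of
    type 1 moves faster than the sine. *)
Lemma bernstein_szego h t : contractive_jet h -> h 0 t ^+ 2 + h 1 t ^+ 2 <= 1.
Proof.
move=> hh; apply/ler_addgt0Pr => d d0.
have cv : (2^-1 : R) ^+ n @[n --> \oo] --> (0 : R).
  by apply: cvg_expr; rewrite ger0_norm//; lra.
have /(_ _ d d0) [N _ /(_ N (leqnn _))] := cvgr0_norm_lt _ cv.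
rewrite /= ger0_norm ?exprn_ge0// => Nd.
have := energy_bound N t hh; move: Nd.
have : 0 <= (2^-1 : R) ^+ N by rewrite exprn_ge0.
move: ((2^-1 : R) ^+ N) => c.
have := sqr_ge0 (h 0 t).
nra.
Qed.

End BernsteinSzego.

(** * Bounded operators *)

Section BlinTheory.
Context {R : realType} {E F : normedModType R}.
Implicit Types f g : blin E F.

Lemma blinD f x y : f (x + y) = f x + f y.
Proof. by have := blin_linear f 1 x y; rewrite !scale1r. Qed.

Lemma blinN f x : f (- x) = - f x.
Proof. by rewrite -scaleN1r blinZ scaleN1r. Qed.

Lemma blinB f x y : f (x - y) = f x - f y.
Proof. by rewrite blinD blinN. Qed.

Lemma blinDE f g x : (f + g) x = f x + g x. Proof. by []. Qed.
Lemma blinNE f x : (- f) x = - f x. Proof. by []. Qed.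
Lemma blinBE f g x : (f - g) x = f x - g x. Proof. by []. Qed.
Lemma blinZE a f x : (a *: f) x = a *: f x. Proof. by []. Qed.
Lemma blin0E x : (0 : blin E F) x = 0. Proof. by []. Qed.

Lemma ler_blin f x : `|f x| <= `|f| * `|x|.
Proof. exact: ler_opnorm. Qed.

Lemma ler_blin1 f x : `|x| <= 1 -> `|f x| <= `|f|.
Proof. by move=> x1; rewrite (le_trans (ler_blin f x))// ler_piMr. Qed.

Lemma blin_norm_le f (M : R) : 0 <= M -> (forall x, `|f x| <= M * `|x|) -> `|f| <= M.
Proof.
move=> M0 fM; apply: opnorm_le => x x1; rewrite (le_trans (fM x))//.
by rewrite ler_piMr.
Qed.

Lemma blin_continuous f : continuous f.
Proof.
move=> x; apply/cvgrPdist_le => e e0.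
have M0 : 0 < `|f| + 1 by rewrite ltr_wpDl.
near=> y; rewrite -blinB (le_trans (ler_blin _ _))//.
rewrite (@le_trans _ _ ((`|f| + 1) * `|x - y|))// ?ler_wpM2r ?lerDl//.
rewrite -ler_pdivlMl//; near: y; apply: cvgr_dist_le => //.
by rewrite mulr_gt0 ?invr_gt0.
Unshelve. all: by end_near. Qed.

Lemma blin_cvg {T} (G : set_system T) {FG : Filter G} f (u : T -> E) (l : E) :
  u @ G --> l -> f (u x) @[x --> G] --> f l.
Proof. by move=> ul; apply: continuous_cvg => //; exact: blin_continuous. Qed.

Lemma blin_eval_cvg {T} (G : set_system T) {FG : Filter G} (u : T -> blin E F) (l : blin E F) x :
  u @ G --> l -> u t x @[t --> G] --> l x.
Proof.
move=> /cvgrPdist_lt ul; apply/cvgrPdist_le => e e0.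
have M0 : 0 < `|x| + 1 by rewrite ltr_wpDl.
have /ul : 0 < (`|x| + 1)^-1 * e by rewrite mulr_gt0 ?invr_gt0.
apply: filterS => t ut; rewrite -blinBE (le_trans (ler_blin _ _))//.
rewrite (@le_trans _ _ (`|l - u t| * (`|x| + 1)))// ?ler_wpM2l ?lerDl//.
by rewrite mulrC -ler_pdivlMl// ltW.
Qed.

End BlinTheory.

Arguments blin_cvg {R E F T G FG} f {u l}.
Arguments blin_eval_cvg {R E F T G FG u l} x.

Section BlinComplete.
Context {R : realType} {E : normedModType R} {F : completeNormedModType R}.

(** Pointwise limits exist because [F] is complete, and the Cauchy estimates pass to
    them uniformly on the unit ball. *)
Lemma blin_complete (G : set_system (blin E F)) :
  ProperFilter G -> cauchy G -> cvg G.
Proof.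
move=> FG cG.
have cGn e : 0 < e -> exists2 A, G A & forall f g, A f -> A g -> `|f - g| <= e.
  move=> e0; have /cauchy_ballP/(_ _ e0) := cG.
  case=> -[A B] /= [GA GB] AB; exists (A `&` B); first exact: filterI.
  move=> f g [Af _] [_ Bg]; have := AB (f, g) (conj Af Bg).
  by rewrite -ball_normE/= => /ltW.
have cGx x : cvg (f x @[f --> G]).
  apply: cauchy_cvg; apply/cauchy_ballP => e e0.
  have M0 : 0 < `|x| + 1 by rewrite ltr_wpDl.
  have [|A GA Ae] := cGn ((`|x| + 1)^-1 * (e / 2)).
    by rewrite mulr_gt0 ?invr_gt0 ?divr_gt0.
  pose AxE : set F := [set (f : blin E F) x | f in A].
  have GAx : G [set f : blin E F | AxE (f x)].
    by apply: filterS GA => f Af; exists f.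
  exists (AxE, AxE); first by split; exact: GAx.
  move=> [_ _]/= [[f Af <-] [g Ag <-]]; rewrite -ball_normE/= -blinBE.
  rewrite (@le_lt_trans _ _ (e / 2)) ?ltr_pdivrMr ?ltr_pMr ?ltr1n//.
  rewrite (le_trans (ler_blin _ _))// (@le_trans _ _ (`|f - g| * (`|x| + 1)))//.
    by rewrite ler_wpM2l ?lerDl.
  by rewrite mulrC -ler_pdivlMl// Ae.
pose l x := lim (f x @[f --> G]).
have lP e : 0 < e -> exists2 A, G A & forall f x, A f -> `|f x - l x| <= e * `|x|.
  move=> e0; have [A GA Ae] := cGn e e0; exists A => // f x Af.
  have := cGx x => /(@cvgB _ _ _ G _ (fun=> f x) _ _ _ (cvg_cst _)).
  move=> /cvg_norm => fl; apply: (closed_cvg (fun y => y <= e * `|x|) _ _ _ fl).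
    exact: closed_le.
  apply: filterS GA => g Ag; rewrite [_ g](_ : _ = (f - g) x)// (le_trans (ler_blin _ _))//.
  by rewrite ler_wpM2r// Ae.
have ll : linear l.
  move=> a x y.
  have : (fun f : blin E F => a *: f x + f y) @ G --> a *: l x + l y.
    by apply: cvgD; [apply: cvgZr; exact: cGx|exact: cGx].
  have -> : (fun f : blin E F => a *: f x + f y) = fun f => f (a *: x + y).
    by apply/funext => f; rewrite blin_linear.
  by move/cvg_lim; apply.
have lB : is_blin l.
  split => //; have [A GA Ae] := lP 1 ltr01.
  have [f Af] := filter_ex GA; exists (1 + `|f|) => x.
  rewrite -[l x](subKr (f x)) (le_trans (ler_normB _ _))//.
  by rewrite mulrDl addrC lerD// ?ler_blin// Ae.
pose L : blin E F := BLin (asboolT lB).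
apply/cvg_ex; exists L; apply/cvgrPdist_le => e e0.
have [A GA Ae] := lP e e0; apply: filterS GA => f Af.
rewrite distrC; apply: blin_norm_le => [|x]; first exact: ltW.
exact: Ae.
Qed.

HB.instance Definition _ :=
  Uniform_isComplete.Build (blin E F) blin_complete.

End BlinComplete.

(** * Differential calculus of bounded bilinear maps *)

Section Curves.
Context {R : realType}.

Lemma is_derive1P {E : normedModType R} (c : R -> E) (t : R) (w : E) :
  is_derive t 1 c w <-> u^-1 *: (c (u + t) - c t) @[u --> 0^'] --> w.
Proof.
have cE : (fun h : R => h^-1 *: ((c \o shift t) (h *: 1) - c t)) =
    fun u => u^-1 *: (c (u + t) - c t).
  by apply/funext => h; rewrite /= [h *: 1]mulr1.
split=> [[dc <-]|cw]; first by rewrite -cE; exact: dc.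
split; first by apply/cvg_ex; exists w; rewrite cE.
by rewrite /derive cE; apply/cvg_lim.
Qed.

Lemma is_derive1_cont {E : normedModType R} (c : R -> E) (t : R) (w : E) :
  is_derive t 1 c w -> {for t, continuous c}.
Proof. by case=> dc _; apply/differentiable_continuous/derivable1_diffP. Qed.

Lemma cvg_le0 {E : normedModType R} {T} (G : set_system T) {FG : Filter G}
    (u : T -> E) (l : E) (r : T -> R) :
  (\forall t \near G, `|u t - l| <= r t) -> r @ G --> (0 : R) -> u @ G --> l.
Proof.
move=> ur r0; apply/subr_cvg0/norm_cvg0P.
apply: (@squeeze_cvgr _ _ _ _ (cst 0) r) => //; last exact: cvg_cst.
by apply: filterS ur => t ->; rewrite normr_ge0.
Qed.

Lemma shift_cvg {E : normedModType R} (c : R -> E) (t : R) :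
  {for t, continuous c} -> c (u + t) @[u --> 0^'] --> c t.
Proof.
move=> ct; apply: cvg_within_filter.
have tt : (fun u : R => u + t) @ (0 : R) --> 0 + t.
  by apply: cvgD; [exact: cvg_id|exact: cvg_cst].
rewrite add0r in tt; exact: (@cvg_comp _ _ _ _ c _ _ _ tt ct).
Qed.

Lemma blin_is_derive {E F : normedModType R} (f : blin E F) (c : R -> E) (t : R) (w : E) :
  is_derive t 1 c w -> is_derive t 1 (f \o c) (f w).
Proof.
move=> /is_derive1P cw; apply/is_derive1P.
rewrite (_ : (fun u => _) = fun u : R => f (u^-1 *: (c (u + t) - c t))).
  exact: (blin_cvg f cw).
by apply/funext => u; rewrite /= blinZ blinB.
Qed.

End Curves.

Section BoundedBilinear.
Context {R : realType} {E1 E2 F : normedModType R} (B : E1 -> E2 -> F).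
Hypothesis Bl : forall y, linear (B^~ y).
Hypothesis Br : forall x, linear (B x).
Hypothesis B_norm : forall x y, `|B x y| <= `|x| * `|y|.

Let BD1 x x' y : B (x + x') y = B x y + B x' y.
Proof. by have := Bl y 1 x x'; rewrite !scale1r. Qed.
Let BD2 x y y' : B x (y + y') = B x y + B x y'.
Proof. by have := Br x 1 y y'; rewrite !scale1r. Qed.
Let B01 y : B 0 y = 0.
Proof. by have := BD1 0 0 y; rewrite addr0 => /eqP; rewrite -subr_eq subrr eq_sym => /eqP. Qed.
Let B02 x : B x 0 = 0.
Proof. by have := BD2 x 0 0; rewrite addr0 => /eqP; rewrite -subr_eq subrr eq_sym => /eqP. Qed.
Let BZ1 a x y : B (a *: x) y = a *: B x y.
Proof. by have := Bl y a x 0; rewrite addr0 B01 addr0. Qed.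
Let BZ2 a x y : B x (a *: y) = a *: B x y.
Proof. by have := Br x a y 0; rewrite addr0 B02 addr0. Qed.
Let BB1 x x' y : B (x - x') y = B x y - B x' y.
Proof. by rewrite BD1 -scaleN1r BZ1 scaleN1r. Qed.
Let BB2 x y y' : B x (y - y') = B x y - B x y'.
Proof. by rewrite BD2 -scaleN1r BZ2 scaleN1r. Qed.

(** This and the product rule below are used for the composition of operators, for
    the evaluation of an operator at a vector and for the Jordan product. *)
Lemma bilin_cvg {T} (G : set_system T) {FG : Filter G}
    (u : T -> E1) (v : T -> E2) (f : E1) (g : E2) :
  u @ G --> f -> v @ G --> g -> B (u t) (v t) @[t --> G] --> B f g.
Proof.
move=> uf vg.
have uf0 : `|u t - f| @[t --> G] --> (0 : R) by apply/norm_cvg0P/subr_cvg0.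
have vg0 : `|v t - g| @[t --> G] --> (0 : R) by apply/norm_cvg0P/subr_cvg0.
apply: (@cvg_le0 _ _ _ _ _ _ _
  (fun t => `|u t - f| * (`|v t - g| + `|g|) + `|f| * `|v t - g|)).
  apply: nearW => t.
  have -> : B (u t) (v t) - B f g = B (u t - f) (v t - g + g) + B f (v t - g).
    by rewrite subrK BB1 BB2 addrA subrK.
  rewrite (le_trans (ler_normD _ _))// lerD//.
  by apply: (le_trans (B_norm _ _)); apply: ler_wpM2l => //; exact: ler_normD.
rewrite -[X in _ --> X](_ : 0 * (0 + `|g|) + `|f| * 0 = 0); last first.
  by rewrite mul0r mulr0 addr0.
apply: cvgD; first by apply: cvgM => //; apply: cvgD => //; exact: cvg_cst.
by apply: cvgM => //; exact: cvg_cst.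
Qed.

Lemma bilin_is_derive (c : R -> E1) (d : R -> E2) (t : R) (c' : E1) (d' : E2) :
  is_derive t 1 c c' -> is_derive t 1 d d' ->
  is_derive t 1 (fun s => B (c s) (d s)) (B c' (d t) + B (c t) d').
Proof.
move=> dc dd; have := is_derive1_cont dd => /shift_cvg dt.
move: dc dd => /is_derive1P cc /is_derive1P cd; apply/is_derive1P.
rewrite (_ : (fun u => _) = fun u : R =>
    B (u^-1 *: (c (u + t) - c t)) (d (u + t)) +
    B (c t) (u^-1 *: (d (u + t) - d t))).
  apply: cvgD; first exact: bilin_cvg.
  by apply: bilin_cvg => //; exact: cvg_cst.
apply/funext => u; rewrite BZ1 BZ2 -scalerDr; congr (_ *: _).
by rewrite BB1 BB2 addrA subrK.
Qed.

End BoundedBilinear.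

Section OperatorAlgebra.
Context {R : realType} {E : normedModType R}.
Implicit Types f g h : blin E E.

Lemma bcompE f g x : bcomp f g x = f (g x). Proof. by []. Qed.
Lemma bidE x : @bid R E x = x. Proof. by []. Qed.

Lemma bcompA f g h : bcomp f (bcomp g h) = bcomp (bcomp f g) h.
Proof. exact: blinP. Qed.
Lemma bcomp1f f : bcomp (bid E) f = f. Proof. exact: blinP. Qed.
Lemma bcompf1 f : bcomp f (bid E) = f. Proof. exact: blinP. Qed.
Lemma bcompDl f g h : bcomp (f + g) h = bcomp f h + bcomp g h.
Proof. exact: blinP. Qed.
Lemma bcompBl f g h : bcomp (f - g) h = bcomp f h - bcomp g h.
Proof. exact: blinP. Qed.
Lemma bcompZl a f g : bcomp (a *: f) g = a *: bcomp f g.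
Proof. exact: blinP. Qed.
Lemma bcomp0l f : bcomp 0 f = 0. Proof. exact: blinP. Qed.
Lemma bcompDr f g h : bcomp f (g + h) = bcomp f g + bcomp f h.
Proof. by apply: blinP => x; exact: blinD. Qed.
Lemma bcompBr f g h : bcomp f (g - h) = bcomp f g - bcomp f h.
Proof. by apply: blinP => x; exact: blinB. Qed.
Lemma bcompZr a f g : bcomp f (a *: g) = a *: bcomp f g.
Proof. by apply: blinP => x; exact: blinZ. Qed.
Lemma bcomp0r f : bcomp f 0 = 0.
Proof. by apply: blinP => x; exact: blin0. Qed.

Lemma bcomp_norm f g : `|bcomp f g| <= `|f| * `|g|.
Proof.
apply: blin_norm_le => [|x]; first exact: mulr_ge0.
apply: (le_trans (ler_blin f (g x))).
by rewrite -mulrA; apply: ler_wpM2l => //; exact: ler_blin.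
Qed.

Lemma bid_norm : `|bid E| <= 1.
Proof. by apply: blin_norm_le => // x; rewrite mul1r. Qed.

Let bcomp_linl h : linear (fun f => bcomp f h).
Proof. by move=> a f g; rewrite bcompDl bcompZl. Qed.
Let bcomp_linr f : linear (bcomp f).
Proof. by move=> a g h; rewrite bcompDr bcompZr. Qed.

Lemma bcomp_cvg {T} (G : set_system T) {FG : Filter G} (u v : T -> blin E E) (f g : blin E E) :
  u @ G --> f -> v @ G --> g -> bcomp (u t) (v t) @[t --> G] --> bcomp f g.
Proof. exact: (bilin_cvg bcomp_linl bcomp_linr bcomp_norm). Qed.

Lemma bcomp_is_derive (c d : R -> blin E E) (t : R) (c' d' : blin E E) :
  is_derive t 1 c c' -> is_derive t 1 d d' ->
  is_derive t 1 (fun s => bcomp (c s) (d s)) (bcomp c' (d t) + bcomp (c t) d').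
Proof. exact: (bilin_is_derive bcomp_linl bcomp_linr bcomp_norm). Qed.

End OperatorAlgebra.

Section Evaluation.
Context {R : realType} {E F : normedModType R}.

Let eval_linl x : linear (fun f : blin E F => f x). Proof. by []. Qed.
Let eval_linr (f : blin E F) : linear f. Proof. exact: blin_linear. Qed.

Lemma eval_is_derive (c : R -> blin E F) (d : R -> E) (t : R) (c' : blin E F) (d' : E) :
  is_derive t 1 c c' -> is_derive t 1 d d' ->
  is_derive t 1 (fun s => c s (d s)) (c' (d t) + c t d').
Proof. exact: (bilin_is_derive eval_linl eval_linr (@ler_blin _ _ _)). Qed.

Lemma blin_eval_is_derive (c : R -> blin E F) (t : R) (w : blin E F) x :
  is_derive t 1 c w -> is_derive t 1 (fun s => c s x) (w x).
Proof.
move=> dc; have := eval_is_derive dc (is_derive_cst x t 1).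
by rewrite blin0 addr0.
Qed.

End Evaluation.

(** * The exponential of a bounded operator *)

Lemma pow_deriv_bound {R : realType} (t : R) n : `|n%:R * t ^+ n.-1| <= (`|t| + 1) ^+ n.
Proof.
elim: n => [|n IH]; first by rewrite mul0r normr0.
have [->|n0] := eqVneq n 0%N; first by rewrite expr0 mulr1 expr1 normr1 lerDr.
rewrite -add1n natrD mulrDl mul1r exprS mulrDl mul1r addrC.
rewrite (le_trans (ler_normD _ _))// lerD//; last first.
  by rewrite normrX lerXn2r ?nnegrE ?lerDl// addr_ge0.
have -> : n%:R * t ^+ n = t * (n%:R * t ^+ n.-1) :> R.
  by rewrite mulrCA -exprS prednK// lt0n.
by rewrite normrM ler_wpM2l.
Qed.

Lemma taylor_pow_bound {R : realType} (t s : R) n : `|s| <= 1 ->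
  `|(t + s) ^+ n - t ^+ n - s * (n%:R * t ^+ n.-1)| <= s ^+ 2 * (`|t| + 2) ^+ n.
Proof.
move=> s1; elim: n => [|n IH].
  by rewrite !expr0 subrr mul0r mulr0 subrr normr0 mulr1 sqr_ge0.
have -> : (t + s) ^+ n.+1 - t ^+ n.+1 - s * (n.+1%:R * t ^+ n) =
    (t + s) * ((t + s) ^+ n - t ^+ n - s * (n%:R * t ^+ n.-1))
    + s ^+ 2 * (n%:R * t ^+ n.-1).
  case: n {IH} => [|n]; first by rewrite !expr0; ring.
  by rewrite /= -!natr1 !exprS; ring.
have -> : s ^+ 2 * (`|t| + 2) ^+ n.+1 =
    (`|t| + 1) * (s ^+ 2 * (`|t| + 2) ^+ n) + s ^+ 2 * (`|t| + 2) ^+ n.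
  by rewrite (exprS _ n); ring.
rewrite (le_trans (ler_normD _ _))// lerD//.
  rewrite normrM ler_pM//; by rewrite (le_trans (ler_normD _ _))// lerD.
rewrite normrM ger0_norm ?sqr_ge0// ler_wpM2l ?sqr_ge0//.
rewrite (le_trans (pow_deriv_bound _ _))//.
by rewrite lerXn2r ?nnegrE ?addr_ge0// lerD// ler1n.
Qed.

Section Exponential.
Context {R : realType} {E : completeNormedModType R}.
Implicit Types X : blin E E.

Local Notation pow X n := (iter n (bcomp X) (bid E)).

Lemma bpow_norm X n : `|pow X n| <= `|X| ^+ n.
Proof.
elim: n => [|n IH]; first by rewrite expr0 bid_norm.
by rewrite exprS (le_trans (bcomp_norm _ _))// ler_wpM2l.
Qed.

Lemma bpowZ (t : R) X n : pow (t *: X) n = t ^+ n *: pow X n.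
Proof.
elim: n => [|n IH]; first by rewrite expr0 scale1r.
by rewrite iterS IH bcompZl bcompZr scalerA -exprS.
Qed.

Definition exp_term X n : blin E E := n`!%:R^-1 *: pow X n.

Lemma exp_term_norm X n : `|exp_term X n| <= exp_coeff `|X| n.
Proof.
rewrite /exp_term /exp_coeff normrZ ger0_norm ?invr_ge0// mulrC.
by rewrite ler_wpM2r ?invr_ge0// bpow_norm.
Qed.

Lemma bexp_cvg X : series (exp_term X) @ \oo --> bexp X.
Proof.
suff : cvgn (series (exp_term X)) by [].
apply: normed_cvg; apply: (@series_le_cvg _ _ (exp_coeff `|X|)) => //.
- by move=> n /=.
- by move=> n; exact: exp_coeff_ge0.
- by move=> n; exact: exp_term_norm.
- exact: is_cvg_series_exp_coeff.
Qed.

(** The partial sums of the exponential series satisfy a second order Taylor estimate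
    whose constant does not depend on the number of terms, and such an estimate
    passes to the limit. *)
Lemma bexp_is_derive X (t : R) :
  is_derive t 1 (fun s => bexp (s *: X)) (bcomp X (bexp (t *: X))).
Proof.
pose C := expR ((`|t| + 2) * `|X|).
have key (s : R) : `|s| <= 1 ->
    `|bexp ((s + t) *: X) - bexp (t *: X) - s *: bcomp X (bexp (t *: X))| <= s ^+ 2 * C.
  move=> s1.
  have part N : `|series (exp_term ((s + t) *: X)) N.+1 -
      series (exp_term (t *: X)) N.+1 -
      s *: bcomp X (series (exp_term (t *: X)) N)| <= s ^+ 2 * C.
    have -> : bcomp X (series (exp_term (t *: X)) N) =
        \sum_(0 <= n < N.+1) (n`!%:R^-1 * (n%:R * t ^+ n.-1)) *: pow X n.
      rewrite big_nat_recl// mul0r mulr0 scale0r add0r /series/=.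
      elim: N => [|N IH]; first by rewrite !big_geq// bcomp0r.
      rewrite !big_nat_recr//= bcompDr IH; congr (_ + _).
      rewrite /exp_term bcompZr bpowZ bcompZr scalerA; congr (_ *: _).
      rewrite factS natrM invfM; field.
      by rewrite -(natrD _ 1) !pnatr_eq0 -lt0n fact_gt0.
    rewrite /series/= scaler_sumr -!sumrB.
    have le n : `|exp_term ((s + t) *: X) n - exp_term (t *: X) n -
        s *: ((n`!%:R^-1 * (n%:R * t ^+ n.-1)) *: pow X n)| <=
        s ^+ 2 * exp_coeff ((`|t| + 2) * `|X|) n.
      rewrite /exp_term !bpowZ !scalerA -!scalerBl normrZ.
      have -> : n`!%:R^-1 * (s + t) ^+ n - n`!%:R^-1 * t ^+ n -
          s * (n`!%:R^-1 * (n%:R * t ^+ n.-1)) =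
          n`!%:R^-1 * ((t + s) ^+ n - t ^+ n - s * (n%:R * t ^+ n.-1)).
        by rewrite (addrC s); ring.
      rewrite normrM ger0_norm ?invr_ge0// /exp_coeff /= exprMn.
      rewrite (_ : s ^+ 2 * _ = n`!%:R^-1 * (s ^+ 2 * (`|t| + 2) ^+ n) * `|X| ^+ n); last ring.
      rewrite ler_pM ?mulr_ge0 ?invr_ge0// ?bpow_norm// ler_wpM2l ?invr_ge0//.
      exact: taylor_pow_bound.
    apply: (le_trans (ler_norm_sum _ _ _)).
    apply: (@le_trans _ _ (\sum_(0 <= n < N.+1) s ^+ 2 * exp_coeff ((`|t| + 2) * `|X|) n)).
      by apply: ler_sum => n _; exact: le.
    rewrite -mulr_sumr ler_wpM2l ?sqr_ge0//.
    apply: (@nondecreasing_cvgn_le _ (series (exp_coeff ((`|t| + 2) * `|X|)))).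
      apply/nondecreasing_series => n _ _; apply: exp_coeff_ge0.
      by rewrite mulr_ge0// addr_ge0.
    exact: is_cvg_series_exp_coeff.
  have cv : `|series (exp_term ((s + t) *: X)) N.+1 -
      series (exp_term (t *: X)) N.+1 -
      s *: bcomp X (series (exp_term (t *: X)) N)| @[N --> \oo] -->
      `|bexp ((s + t) *: X) - bexp (t *: X) - s *: bcomp X (bexp (t *: X))|.
    apply: cvg_norm; apply: cvgB; last first.
      by apply: cvgZr; apply: bcomp_cvg; [exact: cvg_cst|exact: bexp_cvg].
    by apply: cvgB; rewrite (cvg_shiftS (series _)); exact: bexp_cvg.
  apply: (closed_cvg (fun y => y <= s ^+ 2 * C) _ _ _ cv); first exact: closed_le.
  exact: nearW.
apply/is_derive1P.
apply: (@cvg_le0 _ _ _ _ _ _ _ (fun u => `|u| * C)).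
  near=> u.
  have u1 : `|u| <= 1.
    by near: u; exact: dnbhs0_le.
  have u0 : u != 0 by near: u; exact: nbhs_dnbhs_neq.
  rewrite -[X in _ - X]scale1r -(mulVf u0) -scalerA -scalerBr normrZ normfV.
  rewrite ler_pdivrMl ?normr_gt0// mulrA -expr2 real_normK ?num_real//.
  exact: key.
have cv : (fun u : R => `|u|) @ (0 : R) --> `|0 : R|.
  by apply: cvg_norm; exact: cvg_id.
have cvC : (fun u : R => `|u| * C) @ 0^' --> `|0 : R| * C.
  by apply: cvgM; [exact: cvg_within_filter|exact: cvg_cst].
by rewrite normr0 mul0r in cvC.
Unshelve. all: by end_near. Qed.

Lemma bexp0 : bexp (0 : blin E E) = bid E.
Proof.
apply: cvg_lim => //; rewrite -cvg_shiftS.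
apply: (@cvg_le0 _ _ _ _ _ _ _ (fun=> 0)); last exact: cvg_cst.
apply: nearW => n; rewrite /series/= big_nat_recl//= big1 ?addr0.
  by rewrite fact0 invr1 scale1r subrr normr0.
by move=> i _; rewrite /= bcomp0l scaler0.
Qed.

Lemma bpow_comm X n : bcomp (pow X n) X = bcomp X (pow X n).
Proof.
elim: n => [|n IH]; first by rewrite bcomp1f bcompf1.
by rewrite !iterS -bcompA IH.
Qed.

Lemma bexp_comm X (t : R) : bcomp (bexp (t *: X)) X = bcomp X (bexp (t *: X)).
Proof.
have lcv : bcomp (series (exp_term (t *: X)) n) X @[n --> \oo] -->
    bcomp (bexp (t *: X)) X by apply: bcomp_cvg; [exact: bexp_cvg|exact: cvg_cst].
have rcv : bcomp X (series (exp_term (t *: X)) n) @[n --> \oo] -->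
    bcomp X (bexp (t *: X)) by apply: bcomp_cvg; [exact: cvg_cst|exact: bexp_cvg].
apply: (cvg_unique (@norm_hausdorff _ _) lcv).
rewrite (_ : (fun n => _) = fun n => bcomp X (series (exp_term (t *: X)) n))//.
apply/funext => n; rewrite /series/=; elim: n => [|n IH].
  by rewrite !big_geq// bcomp0l bcomp0r.
rewrite !big_nat_recr//= bcompDl bcompDr IH; congr (_ + _).
by rewrite /exp_term bcompZl bcompZr bpowZ bcompZl bcompZr bpow_comm.
Qed.

End Exponential.

(** * The Hahn-Banach theorem *)

Section HahnBanach.
Context {R : realType} {E : normedModType R} (x0 : E).

(** Graphs of linear functionals on subspaces, dominated by the norm even after
    multiples of [(x0, |x0|)] are added. This forces the maximal graphs through
    [(x0, |x0|)], and admits the empty graph, as required of the union of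
    an empty chain. *)
Definition norming_graph (G : set (E * R)) : Prop :=
  (forall a p q, G p -> G q -> G (a *: p.1 + q.1, a * p.2 + q.2)) /\
  (forall p s, G p -> p.2 + s * `|x0| <= `|p.1 + s *: x0|).

(** A value at [y] is admissible when it lies between two families of real numbers;
    that [G] is dominated says exactly that the first family is below the second,
    so the supremum of the first one will do. *)
Lemma norming_graph_extend G y : norming_graph G -> G (0, 0) ->
  exists c, norming_graph [set p | exists2 q, G q & exists a : R,
    p = (q.1 + a *: y, q.2 + a * c)].
Proof.
move=> [Glin Gdom] G0.
pose A := [set r | exists2 p : E * R, G p & exists s : R,
  r = p.2 + s * `|x0| - `|p.1 - y + s *: x0| ].
have Aub q t : G q -> ubound A (`|q.1 + y + t *: x0| - q.2 - t * `|x0|).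
  move=> Gq _ [p Gp [s ->]].
  have := Gdom _ (s + t) (Glin 1 _ _ Gp Gq); rewrite /= scale1r mul1r => H.
  have : `|p.1 + q.1 + (s + t) *: x0| <=
      `|p.1 - y + s *: x0| + `|q.1 + y + t *: x0|.
    apply: le_trans (ler_normD _ _); rewrite scalerDl.
    by rewrite (addrACA (p.1 - y)) (addrACA p.1 (- y)) addNr addr0.
  move: H; rewrite mulrDl; lra.
have A0 : A !=set0.
  by exists (0 + 0 * `|x0| - `|0 - y + 0 *: x0|), (0, 0) => //; exists 0.
have supA : has_sup A.
  split => //; exists (`|0 + y + 0 *: x0| - 0 - 0 * `|x0|); exact: (Aub (0, 0)).
pose c := sup A.
have cle p s : G p -> p.2 - c + s * `|x0| <= `|p.1 - y + s *: x0|.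
  move=> Gp; have : p.2 + s * `|x0| - `|p.1 - y + s *: x0| <= c.
    by apply: (sup_upper_bound supA); exists p => //; exists s.
  lra.
have cge p s : G p -> p.2 + c + s * `|x0| <= `|p.1 + y + s *: x0|.
  move=> Gp; have : c <= `|p.1 + y + s *: x0| - p.2 - s * `|x0|.
    by apply: ge_sup => //; exact: Aub.
  lra.
have Gscale a p : G p -> G (a *: p.1, a * p.2).
  by move=> Gp; have := Glin a _ _ Gp G0; rewrite /= !addr0.
exists c; split.
  move=> a _ _ [p Gp [s ->]] [q Gq [t ->]] /=.
  exists (a *: p.1 + q.1, a * p.2 + q.2); first exact: Glin.
  exists (a * s + t); rewrite /=; congr (_, _); last ring.
  by rewrite scalerDr scalerDl scalerA addrACA.
move=> _ s [p Gp [a ->]] /=.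
have scale (b : R) (z : E) (r : R) : 0 < b -> b^-1 * r <= `|b^-1 *: z| -> r <= `|z|.
  move=> b0; rewrite normrZ gtr0_norm ?invr_gt0// ler_pM2l ?invr_gt0//.
have le_eq2 (a1 b1 c1 d1 : R) : a1 = b1 -> c1 = d1 -> b1 <= d1 -> a1 <= c1.
  by move=> -> ->.
have [a0|a0|->] := ltgtP a 0; last by rewrite mul0r scale0r !addr0; exact: Gdom.
- have na0 : 0 < - a by rewrite oppr_gt0.
  apply: (scale (- a)) => //; apply: le_eq2 (cle _ ((- a)^-1 * s) (Gscale (- a)^-1 _ Gp)).
    by rewrite /=; field; rewrite lt_eqF.
  by rewrite !scalerDr !scalerA invrN mulNr mulVf ?lt_eqF// scaleN1r.
- apply: (scale a) => //; apply: le_eq2 (cge _ (a^-1 * s) (Gscale a^-1 _ Gp)).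
    by rewrite /=; field; rewrite gt_eqF.
  by rewrite !scalerDr !scalerA mulVf ?gt_eqF// scale1r.
Qed.

Lemma hahn_banach_norming : exists f : blin E R^o, `|f| <= 1 /\ f x0 = `|x0|.
Proof.
have [|G [[Glin Gdom] Gmax]] := @Zorn_bigcup (E * R) norming_graph.
  move=> C CP Ctot; split.
    move=> a p q [X CX Xp] [Y CY Yq].
    have [XY|YX] := Ctot _ _ CX CY.
      by exists Y => //; have [+ _] := CP _ CY; apply => //; exact: XY.
    by exists X => //; have [+ _] := CP _ CX; apply => //; exact: YX.
  by move=> p s [X CX Xp]; have [_] := CP _ CX; exact.
have G0 : G (0, 0).
  have [//|NG0] := pselect (G (0, 0)); exfalso.
  apply: (Gmax (G `|` [set (0, 0)])).
    split; first by move=> p Gp; left.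
    by move=> /(_ (0, 0)) GG; apply: NG0; apply: GG; right.
  have GE p : ~ G p.
    move=> Gp; apply: NG0; have := Glin (-1) _ _ Gp Gp.
    by rewrite scaleN1r mulN1r !addNr.
  split.
    move=> a p q [/GE//|->] [/GE//|->]; right => /=.
    by rewrite scaler0 mulr0 !addr0.
  move=> p s [/GE//|->] /=; rewrite !add0r normrZ.
  by rewrite ler_wpM2r// ler_norm.
have Gtot y : exists c, G (y, c).
  have [c Gc] := norming_graph_extend y (conj Glin Gdom) G0.
  exists c; apply: contrapT => NG; apply: (Gmax _ _ Gc); split.
    by move=> [a r] Gp; exists (a, r) => //; exists 0; rewrite scale0r mul0r !addr0.
  move=> /(_ (y, c)) GG; apply: NG; apply: GG; exists (0, 0) => //.
  by exists 1; rewrite scale1r mul1r !add0r.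
have [f fG] := choice Gtot.
have Gle p : G p -> p.2 <= `|p.1|.
  by move=> /(Gdom p 0); rewrite mul0r scale0r !addr0.
have Gfun x r : G (x, r) -> r = f x.
  move=> Gr; have H1 := Glin (-1) _ _ Gr (fG x); have H2 := Glin (-1) _ _ (fG x) Gr.
  have := Gle _ H1; have := Gle _ H2.
  by rewrite /= !scaleN1r !addNr !normr0 !mulN1r; lra.
have flin : linear (f : E -> R^o).
  by move=> a x y; rewrite -(Gfun _ _ (Glin a _ _ (fG x) (fG y))).
have fle x : `|f x| <= `|x|.
  rewrite ler_norml; apply/andP; split; last exact: (Gle _ (fG x)).
  have := Gle _ (Glin (-1) _ _ (fG x) G0).
  by rewrite /= !addr0 scaleN1r normrN mulN1r; lra.
have fb : is_blin (f : E -> R^o) by split=> //; exists 1 => x; rewrite mul1r.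
exists (BLin (asboolT fb)); split.
  by apply: blin_norm_le => // x; rewrite mul1r; exact: fle.
have := Gdom _ 1 (Glin (-1) _ _ (fG x0) G0).
rewrite /= !addr0 !scaleN1r scale1r addNr normr0 mulN1r mul1r => H.
by have := Gle _ (fG x0); rewrite /= => H'; apply/eqP; rewrite eq_le H'/=; lra.
Qed.

End HahnBanach.

(** * Flows of isometries *)

Section Duality.
Context {R : realType}.

Lemma vector_norm_le {E : normedModType R} (x : E) (c : R) :
  (forall f : dual E, `|f| <= 1 -> f x <= c) -> `|x| <= c.
Proof. by move=> H; have [f [f1 <-]] := hahn_banach_norming x; exact: H. Qed.

Lemma blin_norm_le_dual {E : normedModType R} (T : blin E E) (c : R) :
  (forall (f : dual E) x, `|f| <= 1 -> `|x| <= 1 -> f (T x) <= c) -> `|T| <= c.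
Proof.
by move=> H; apply: opnorm_le => x x1; apply: vector_norm_le => f f1; exact: H.
Qed.

Lemma dual_le1 {E : normedModType R} (f : dual E) x : `|f| <= 1 -> `|x| <= 1 -> `|f x| <= 1.
Proof. by move=> f1 x1; rewrite (le_trans (ler_blin1 f x1)). Qed.

(** The mean value theorem for the scalar functions [f \o c]. *)
Lemma is_derive0_cst {E : normedModType R} (c : R -> E) (a b : R) : a <= b ->
  (forall t : R, t \in `]a, b[ -> is_derive t 1 c 0) ->
  {within `[a, b], continuous c} -> c a = c b.
Proof.
move=> ab dc cc; apply/eqP; rewrite -subr_eq0 -normr_le0.
apply: vector_norm_le => f _; rewrite blinB.
have [||s _] := @MVT_segment R (fun t => f (c t)) (fun=> 0) a b ab.
- by move=> t tab; have := blin_is_derive f (dc t tab); rewrite blin0.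
- move=> t; apply: (blin_cvg f); exact: cc.
by rewrite mul0r => H; rewrite -opprB H oppr0.
Qed.

Lemma is_derive0_cstT {E : normedModType R} (c : R -> E) (a b : R) :
  (forall t : R, is_derive t 1 c 0) -> c a = c b.
Proof.
move=> dc; wlog ab : a b / a <= b.
  by move=> H; have [|/ltW] := leP a b; [exact: H|move=> /H ->].
apply: is_derive0_cst => //; apply: continuous_subspaceT => t.
by apply: is_derive1_cont.
Qed.

End Duality.

Section Flow.
Context {R : realType} {E : completeNormedModType R}.
Implicit Types X Y T : blin E E.

Definition flow X (t : R) := bexp (t *: X).

Lemma flow_is_derive X (t : R) : is_derive t 1 (flow X) (bcomp X (flow X t)).
Proof. exact: bexp_is_derive. Qed.

Lemma flow_comm X t : bcomp (flow X t) X = bcomp X (flow X t).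
Proof. exact: bexp_comm. Qed.

Lemma flow0 X : flow X 0 = bid E.
Proof. by rewrite /flow scale0r bexp0. Qed.

(** The derivative of [e^{-tX} e^{tX}] vanishes since [X] commutes with its flow. *)
Lemma flowVK X t : bcomp (flow (- X) t) (flow X t) = bid E.
Proof.
have -> : bid E = bcomp (flow (- X) 0) (flow X 0) by rewrite !flow0 bcomp1f.
apply: (@is_derive0_cstT _ _ (fun t => bcomp (flow (- X) t) (flow X t))) => s.
have := bcomp_is_derive (flow_is_derive (- X) s) (flow_is_derive X s).
rewrite -flow_comm -bcompA -bcompDr -bcompDl.
by rewrite addNr bcomp0l bcomp0r.
Qed.

Lemma flowKV X t : bcomp (flow X t) (flow (- X) t) = bid E.
Proof. by have := flowVK (- X) t; rewrite opprK. Qed.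

(** The operator [S |-> X S + S Y] generates the one-parameter group
    [T |-> e^{tX} T e^{tY}], with which it commutes. *)
Lemma flow_jet X Y T (f : dual E) x n (t : R) :
  let Tn n := iter n (fun S => bcomp X S + bcomp S Y) T in
  let h n t := f (flow X t (Tn n (flow Y t x))) : R in
  is_derive t 1 (h n) (h n.+1 t).
Proof.
move=> Tn h; apply: (blin_is_derive f).
have := eval_is_derive (bcomp_is_derive (bcomp_is_derive (flow_is_derive X t)
  (is_derive_cst (Tn n) t 1)) (flow_is_derive Y t)) (is_derive_cst x t 1).
move=> H; apply: (@is_derive_eq _ _ _ _ _ _ _ _ H).
rewrite blin0 addr0 bcomp0r addr0 /Tn iterS -/(Tn n) -flow_comm -(flow_comm Y).
rewrite [RHS](_ : _ = (bcomp (bcomp (flow X t) (bcomp X (Tn n) + bcomp (Tn n) Y)) (flow Y t)) x)//.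
by rewrite bcompDr bcompDl -!bcompA (flow_comm Y).
Qed.

End Flow.

Lemma bernstein_szego_scaled {R : realType} (s : R) (h : nat -> R -> R) t : 0 <= s ->
  (forall n (t : R), is_derive t 1 (h n) (h n.+1 t)) ->
  (forall n t, `|h n t| <= s ^+ n) ->
  h 1 t ^+ 2 <= s ^+ 2 * (1 - h 0 t ^+ 2).
Proof.
rewrite le_eqVlt => /predU1P[<- _ hb|s0 dh hb].
  have := hb 1%N t; rewrite expr1 normr_le0 => /eqP ->.
  by rewrite expr0n/= mul0r.
pose k n u := s^-1 ^+ n * h n (s^-1 * u).
have kk : contractive_jet k.
  move=> n u; split.
    have d1 := dh n (s^-1 * u).
    have d2 : is_derive u 1 (fun u : R => s^-1 * u) s^-1.
      by apply: is_derive_eq; rewrite /GRing.scale/= mulr1.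
    have := @is_deriveZ _ _ _ _ (s^-1 ^+ n) _ _ _ (@is_derive1_comp _ _ _ _ _ _ d1 d2).
    move=> H; apply: (@is_derive_eq _ _ _ _ _ _ _ _ H).
    by rewrite /k exprSr /GRing.scale/=; ring.
  rewrite /k normrM ger0_norm ?exprn_ge0 ?invr_ge0 ?(ltW s0)//.
  by rewrite exprVn ler_pdivrMl ?exprn_gt0// mulr1.
have := bernstein_szego (s * t) kk.
rewrite /k expr0 expr1 mul1r mulKf ?gt_eqF// exprMn => H.
have s2 : 0 < s ^+ 2 by rewrite exprn_gt0.
have e : h 1 t ^+ 2 = s ^+ 2 * (s^-1 ^+ 2 * h 1 t ^+ 2).
  by rewrite mulrA -exprMn divff ?gt_eqF// expr1n mul1r.
by rewrite e ler_pM2l//; lra.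
Qed.

Section OperatorBernstein.
Context {R : realType} {E : completeNormedModType R}.
Implicit Types X Y T : blin E E.

Definition isometric_flow X := forall t, `|flow X t| <= 1.

(** This is [bernstein_szego_scaled] at [t = 0] for the jet of [f (e^{tX} T e^{tY} x)].
    With [Y = 0] it bounds the angular speed of [f (g e^{tX} x)] for an isometry
    [g]; the two-sided form is what compares two exponentials with each other. *)
Lemma flow_rate X Y T (f : dual E) x (s : R) :
  isometric_flow X -> isometric_flow Y -> `|X| + `|Y| <= s ->
  `|T| <= 1 -> `|f| <= 1 -> `|x| <= 1 ->
  (f (X (T x)) + f (T (Y x))) ^+ 2 <= s ^+ 2 * (1 - f (T x) ^+ 2).
Proof.
move=> iX iY XYs T1 f1 x1.
have s0 : 0 <= s by apply: le_trans XYs; exact: addr_ge0.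
pose Tn n := iter n (fun S => bcomp X S + bcomp S Y) T.
pose h n t := f (flow X t (Tn n (flow Y t x))) : R.
have := @bernstein_szego_scaled _ s h 0 s0 (fun n t => flow_jet X Y T f x n t).
rewrite /h !flow0 /= blinD; apply => n t.
have TnB : `|Tn n| <= s ^+ n.
  elim: n => [|n IH]; first by rewrite expr0.
  rewrite exprS /Tn iterS -/(Tn n) (le_trans (ler_normD _ _))//.
  apply: le_trans (lerD (bcomp_norm _ _) (bcomp_norm _ _)) _.
  by rewrite [X in _ + X]mulrC -mulrDl ler_pM// addr_ge0.
apply: (le_trans (ler_blin _ _)); rewrite -[leRHS]mul1r ler_pM//.
apply: (le_trans (ler_blin _ _)); rewrite -[leRHS]mul1r ler_pM//.
apply: (le_trans (ler_blin _ _)); rewrite -[leRHS]mulr1 ler_pM//.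
by rewrite (le_trans (ler_blin1 _ _)).
Qed.

End OperatorBernstein.

(** * Automorphisms and derivations of a JB-algebra *)

Section Inverses.
Context {R : realType} {E : normedModType R}.
Implicit Types f g : blin E E.

Lemma binv_inverse f g : inverse_of f g -> inverse_of f (binv f).
Proof.
by move=> fg; exact: (xgetI 0 fg).
Qed.

Definition isometric f := forall x, `|f x| = `|x|.

Lemma isometric_norm f : isometric f -> `|f| <= 1.
Proof. by move=> fi; apply: blin_norm_le => // x; rewrite fi mul1r. Qed.

Lemma isometric_comp f g : isometric f -> isometric g -> isometric (bcomp f g).
Proof. by move=> fi gi x; rewrite /= fi gi. Qed.

Lemma isometric_bcomp_norm f g : isometric f -> `|bcomp f g| = `|g|.
Proof.
move=> fi; apply/eqP; rewrite eq_le; apply/andP; split.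
  by apply: blin_norm_le => // x; rewrite /= fi ler_blin.
by apply: blin_norm_le => // x; rewrite -fi (ler_blin (bcomp f g)).
Qed.

Lemma isometric_bcomp_normr f g : `|g| <= 1 -> `|bcomp f g| <= `|f|.
Proof. by move=> g1; rewrite (le_trans (bcomp_norm _ _))// ler_piMr. Qed.

Lemma power_bounded_le1 (q M : R) : (forall n, q ^+ (2 ^ n) <= M) -> q <= 1.
Proof.
move=> qM; rewrite leNgt; apply/negP => q1.
have bern m : 1 + m%:R * (q - 1) <= q ^+ m.
  elim: m => [|m IH]; first by rewrite mul0r addr0.
  rewrite exprS -natr1.
  have m0 : 0 <= m%:R :> R by [].
  have := ler_wpM2l (_ : 0 <= q) IH.
  have mq : 0 <= m%:R * ((q - 1) ^+ 2) by rewrite mulr_ge0// sqr_ge0.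
  move=> /(_ ltac:(lra)); lra.
have q0 : 0 < q - 1 by rewrite subr_gt0.
have [n nM] : exists n, M / (q - 1) < n%:R.
  by exists (Num.truncn (M / (q - 1))).+1; exact: truncnS_gt.
have := le_trans (bern _) (qM n); apply/negP; rewrite -ltNge.
rewrite ltr_pdivrMr// in nM.
have : (n%:R : R) * (q - 1) <= (2 ^ n)%:R * (q - 1).
  by rewrite ler_wpM2r ?(ltW q0)// ler_nat ltnW// ltn_expl.
lra.
Qed.

End Inverses.

Section JordanCalculus.
Context {R : realType} {V : jbAlgebraType R}.
Implicit Types (a b x y : V) (k g : blin V V) (D : der V).

Lemma jmul_linl y : linear (fun x : V => jmul x y).
Proof. by move=> a x z; rewrite !(jmulC _ y) jmul_linear. Qed.

Lemma jmul0l x : jmul 0 x = 0 :> V.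
Proof. by have := jmul_linl x (-1) 0 0; rewrite scaler0 addr0 scaleN1r addNr. Qed.

Lemma jmulZl (c : R) x z : jmul (c *: x) z = c *: jmul x z.
Proof. by have /= := jmul_linl z c x 0; rewrite jmul0l !addr0. Qed.

Lemma jmulZr (c : R) x z : jmul z (c *: x) = c *: jmul z x.
Proof. by rewrite ![jmul z _]jmulC jmulZl. Qed.

Lemma jmulBl x y z : jmul (x - y) z = jmul x z - jmul y z.
Proof.
by have /= H := jmul_linl z (-1) y x; rewrite -(scaleN1r y) addrC H scaleN1r addrC.
Qed.

Lemma jmulBr x y z : jmul z (x - y) = jmul z x - jmul z y.
Proof. by rewrite ![jmul z _]jmulC jmulBl. Qed.

Lemma jmul_is_derive (c d : R -> V) (t : R) (c' d' : V) :
  is_derive t 1 c c' -> is_derive t 1 d d' ->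
  is_derive t 1 (fun s => jmul (c s) (d s)) (jmul c' (d t) + jmul (c t) d').
Proof. exact: (bilin_is_derive jmul_linl jmul_linear jnormM). Qed.

Lemma aut_inverse k : Aut V k -> inverse_of k (binv k).
Proof. by case=> -[h kh] _ _; exact: binv_inverse kh. Qed.

Lemma autK k x : Aut V k -> binv k (k x) = x.
Proof. by move=> /aut_inverse[_ kk]; rewrite -[LHS]/(bcomp (binv k) k x) kk. Qed.

Lemma autVK k x : Aut V k -> k (binv k x) = x.
Proof. by move=> /aut_inverse[kk _]; rewrite -[LHS]/(bcomp k (binv k) x) kk. Qed.

Lemma autV k : Aut V k -> Aut V (binv k).
Proof.
move=> Ak; have [_ k1 kM] := Ak; split.
- by exists k; have [] := aut_inverse Ak.
- by rewrite -[in LHS]k1 autK.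
- by move=> a b; rewrite -[a in LHS](autVK a Ak) -[b in LHS](autVK b Ak) -kM autK.
Qed.

Lemma aut_comp k g : Aut V k -> Aut V g -> Aut V (bcomp k g).
Proof.
move=> Ak Ag; have [_ k1 kM] := Ak; have [_ g1 gM] := Ag; split.
- exists (bcomp (binv g) (binv k)); split; apply: blinP => x /=.
    by rewrite !autVK.
  by rewrite !autK.
- by rewrite /= g1.
- by move=> a b; rewrite /= gM kM.
Qed.

(** The norm of [x^(2^n)] is [|x|^(2^n)], and [k] commutes with squaring, so that
    [(|k x| / |x|)^(2^n)] is bounded by the operator norm of [k] for all [n]. *)
Lemma aut_contractive k x : Aut V k -> `|k x| <= `|x|.
Proof.
move=> [_ _ kM]; have [->|x0] := eqVneq x 0; first by rewrite blin0 normr0.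
have x_gt0 : 0 < `|x| by rewrite normr_gt0.
pose sq n y : V := iter n (fun z => jmul z z) y.
have sq_norm n y : `|sq n y| = `|y| ^+ (2 ^ n).
  elim: n => [|n IH]; first by rewrite expr1.
  by rewrite /sq iterS jnorm_sqr -/(sq n y) IH -exprM -expnSr.
have ksq n : k (sq n x) = sq n (k x).
  by elim: n => [//|n IH]; rewrite /sq !iterS kM -/(sq n x) IH.
have := @power_bounded_le1 _ (`|k x| / `|x|) `|k|.
rewrite ler_pdivrMr// mul1r; apply => n.
rewrite exprMn exprVn ler_pdivrMr ?exprn_gt0//.
by rewrite -!sq_norm -ksq; exact: ler_blin.
Qed.

Lemma aut_isometric k : Aut V k -> isometric k.
Proof.
move=> Ak x; apply/eqP; rewrite eq_le aut_contractive//=.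
by rewrite -{1}(autK x Ak) aut_contractive//; exact: autV.
Qed.

Lemma derivationP D x y : D (jmul x y) = jmul (D x) y + jmul x (D y).
Proof. by have /asboolP := der_opP D; apply. Qed.

Lemma derivation_one D : D jone = 0.
Proof.
have := derivationP D jone jone; rewrite (jmulC (D jone)) !jmul1.
by move=> /eqP; rewrite -subr_eq subrr eq_sym => /eqP.
Qed.

(** By the Leibniz rule for [D], the derivative of
    [e^{-tD} (e^{tD} a o e^{tD} b)] vanishes. *)
Lemma flow_aut D t : Aut V (flow D t).
Proof.
split; first by exists (flow (- D : blin V V) t); split; [exact: flowKV|exact: flowVK].
  have := @is_derive0_cstT _ _ (fun t => flow D t jone) t 0; rewrite flow0; apply => s.
  have := blin_eval_is_derive jone (flow_is_derive D s).
  by rewrite -flow_comm/= derivation_one blin0.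
move=> a b.
have key : flow (- D : blin V V) t (jmul (flow D t a) (flow D t b)) = jmul a b.
  have := @is_derive0_cstT _ _ (fun t => flow (- D : blin V V) t
    (jmul (flow D t a) (flow D t b))) t 0.
  rewrite !flow0; apply => s.
  have da := blin_eval_is_derive a (flow_is_derive D s).
  have db := blin_eval_is_derive b (flow_is_derive D s).
  have := eval_is_derive (flow_is_derive (- D : blin V V) s) (jmul_is_derive da db).
  by rewrite -flow_comm bcompE -blinD blinNE -derivationP addNr blin0.
by rewrite -key -[LHS]/(bcomp (flow D t) (flow (- D : blin V V) t) _) flowKV.
Qed.

Lemma der_isometric_flow D : isometric_flow (D : blin V V).
Proof. by move=> t; apply/isometric_norm/aut_isometric/flow_aut. Qed.

Lemma der_norm_op D : `|D| = `|D : blin V V|. Proof. by []. Qed.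

End JordanCalculus.

(** * Arc length *)

Section PiecewisePaths.
Context {R : realType} {E : normedModType R}.

Lemma sub_itv_cont (c : R -> E) (a b a' b' : R) : a <= a' -> b' <= b ->
  {within `[a, b], continuous c} -> {within `[a', b'], continuous c}.
Proof.
move=> aa bb; apply: continuous_subspaceW => t /=; rewrite !in_itv/= => /andP[t1 t2].
by rewrite (le_trans aa t1) (le_trans t2 bb).
Qed.

Lemma within_itv_interior (c : R -> E) (a b t : R) : t \in `]a, b[ ->
  {within `[a, b], continuous c} -> {for t, continuous c}.
Proof.
move=> tab cc; have ab : a < b by move: tab; rewrite in_itv/= => /andP[]; exact: lt_trans.
by have [+ _ _] := (continuous_within_itvP _ ab).1 cc; apply.
Qed.

End PiecewisePaths.

Lemma le_of_derive_off_finite {R : realType} (s : seq R) (F : R -> R) (a b : R) : a <= b ->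
  {within `[a, b], continuous F} ->
  (forall t : R, t \in `]a, b[ -> t \notin s -> exists2 d, is_derive t 1 F d & d <= 0) ->
  F b <= F a.
Proof.
rewrite le_eqVlt => /predU1P[->//|]; elim: s a b => [|x s IH] a b ab cF dF.
  have dF' (t : R) : t \in `]a, b[ -> is_derive t 1 F ('D_1 F t).
    by move=> tab; have [//|d dd _] := dF t tab; apply/derivableP; have [] := dd.
  have [c cI] := MVT ab dF' cF.
  have [//|d [_ dE] d0] := dF c cI.
  move=> /eqP; rewrite subr_eq => /eqP ->; rewrite dE gerDr.
  by rewrite mulr_le0_ge0// subr_ge0 ltW.
have [|xab] := boolP (x \in `]a, b[); last first.
  apply: IH => // t tab ts; apply: dF => //; rewrite in_cons negb_or ts andbT.
  by apply: contraNneq xab => <-.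
rewrite in_itv/= => /andP[ax xb].
apply: (@le_trans _ _ (F x)); apply: IH => //.
- exact: (@sub_itv_cont _ R^o F a b x b (ltW ax) (lexx _) cF).
- move=> t; rewrite in_itv/= => /andP[t1 t2] ts.
  apply: dF; first by rewrite in_itv/= (lt_trans ax t1).
  by rewrite in_cons negb_or ts andbT gt_eqF.
- exact: (@sub_itv_cont _ R^o F a b a x (lexx _) (ltW xb) cF).
- move=> t; rewrite in_itv/= => /andP[t1 t2] ts.
  apply: dF; first by rewrite in_itv/= t1 (lt_trans t2 xb).
  by rewrite in_cons negb_or ts andbT lt_eqF.
Qed.

Section PathLength.
Context {R : realType} {V : jbAlgebraType R}.
Implicit Types (gamma : R -> blin V V).

Lemma C1_on_regular gamma (a b : R) : a <= b -> C1_on gamma a b ->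
  exists M, forall t, t \in `]a, b[ ->
    [/\ derivable gamma t 1, {for t, continuous (derive1 gamma)} & `|derive1 gamma t| <= M].
Proof.
move=> ab [w cw dw].
have cnw : {within `[a, b], continuous (fun t => `|w t|)}.
  by move=> t; apply: cvg_norm; exact: cw.
have [c _ cM] := EVT_max ab cnw; exists `|w c| => t tab.
have dE u : u \in `]a, b[ -> derive1 gamma u = w u.
  by move=> uab; rewrite derive1E; have [] := dw u uab.
split; first by have [] := dw t tab.
- have ct : {for t, continuous w} by exact: within_itv_interior tab cw.
  rewrite /prop_for /continuous_at dE//.
  apply: cvg_trans ct; apply: near_eq_cvg.
  by apply: filterS (near_in_itvoo tab) => u uab; rewrite dE.
- rewrite dE// cM// in_itv/=.
  by move: tab; rewrite in_itv/= => /andP[/ltW -> /ltW ->].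
Qed.

Lemma partition_regular gamma (a b d : R) s : itv_partition a b s ->
  (forall i, (i < size s)%N -> C1_on gamma (nth d (a :: s) i) (nth d (a :: s) i.+1)) ->
  exists M, forall t, t \in `]a, b[ -> t \notin s ->
    [/\ derivable gamma t 1, {for t, continuous (derive1 gamma)} & `|derive1 gamma t| <= M].
Proof.
elim: s a => [|x s IH] a ps Hs.
  exists 0 => t; rewrite (itv_partition_nil ps) in_itv/=.
  by move=> /andP[/lt_trans /[apply]]; rewrite ltxx.
have ax : a < x by have [/= /andP[]] := ps.
have [M1 H1] := C1_on_regular (ltW ax) (Hs 0%N isT).
have [M2 H2] := IH x (itv_partition_cons ps) (fun i Hi => Hs i.+1 Hi).
exists (Num.max M1 M2) => t; rewrite in_itv/= => /andP[ta tb].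
rewrite in_cons negb_or => /andP[tx ts].
have [tltx|xltt|/eqP] := ltgtP t x; last by rewrite (negbTE tx).
  have [|? ? tM] := H1 t; first by rewrite in_itv/= ta.
  by split=> //; rewrite le_max tM.
have [||? ? tM] := H2 t; [by rewrite in_itv/= xltt|by []|].
by split=> //; rewrite le_max tM orbT.
Qed.

(** [S] is the arc length of [gamma]; the finite set [s] collects the break points,
    where [derive1 gamma] carries no information. *)
Definition arc_length (S : R -> R) (s : seq R) gamma :=
  [/\ {within `[0, 1], continuous S}, S 0 = 0
    & forall t : R, t \in `]0, 1[ -> t \notin s ->
      is_derive t 1 gamma (derive1 gamma t) /\ is_derive t 1 S `|derive1 gamma t| ].

(** The operators [binv (gamma t)] are isometries, so the integrand of the length is
    the norm of the derivative. It is bounded, and continuous off a finite set,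
    hence integrable, with a primitive that has the expected derivative at the
    points of continuity. *)
Lemma Aut_path_arc_length gamma :
  (forall t : R, t \in `[0, 1] -> Aut V (gamma t)) -> piecewise_C1 gamma ->
  exists S s, arc_length S s gamma /\ Length gamma = (S 1)%:E.
Proof.
move=> Ag [cg [s ps Hs]].
have [M HM] := partition_regular ps Hs.
pose N t : R := `|derive1 gamma t|.
have LN : Length gamma = (\int[lebesgue_measure]_(t in `[0%R, 1%R]) (N t)%:E)%E.
  apply: eq_integral => t; rewrite inE/= => t01; congr EFin.
  by rewrite /finsler isometric_bcomp_norm//; apply/aut_isometric/autV/Ag.
pose Z : set R := [set` [:: 0, 1 & s]].
pose U : set R := `]0, 1[ `\` [set` s].
have UZ : `[0%R, 1%R] `<=` U `|` Z.
  move=> t /=; rewrite in_itv/= => /andP[t0 t1].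
  have [tZ|tZ] := boolP (t \in [:: 0, 1 & s]); first by right.
  move: tZ; rewrite !in_cons !negb_or => /and3P[tn0 tn1 ts]; left; split => /=.
    by rewrite in_itv/= lt_neqAle eq_sym tn0 t0 lt_neqAle tn1 t1.
  exact/negP.
have cZ : countable Z by exact/finite_set_countable/finite_seq.
have oU : open U.
  apply: openI; first exact: interval_open.
  apply: closed_openC; apply: accessible_finite_set_closed.1; last exact: finite_seq.
  by apply: hausdorff_accessible; exact: Rhausdorff.
(* Whatever the values of [N] on the finite set [Z], it is measurable there. *)
have mZ B : measurable (Z `&` B).
  apply: countable_measurable; first exact: measurable_set1.
  exact: sub_countable (subset_card_le (@subIsetl _ Z B)) cZ.
have mN : measurable_fun (`[0%R, 1%R] : set R) (N : R -> R).
  apply: (@measurable_funS _ _ _ _ (U `|` Z)) => //.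
    by apply: measurableU; [exact: open_measurable|rewrite -(setIT Z)].
  apply/measurable_funU; [exact: open_measurable|by rewrite -(setIT Z)|split].
    apply: open_continuous_measurable_fun => // t /set_mem[t01 /= ts].
    have [||_ ct _] := HM t; [exact: t01|exact/negP|].
    exact: cvg_norm ct.
  by move=> _ B mB; exact: mZ.
have bN : [bounded N t | t in (`[0%R, 1%R] : set R)].
  pose M' := `|M| + \sum_(x <- [:: 0, 1 & s]) N x.
  have s0 : 0 <= \sum_(x <- [:: 0, 1 & s]) N x by apply: sumr_ge0 => x _; exact: normr_ge0.
  exists M'; split; first exact: num_real.
  move=> m M'm t /UZ tUZ; rewrite /= /N normr_id -/(N t) (le_trans _ (ltW M'm))//.
  case: tUZ => [[t01 /= /negP ts]|tZ].
    have [_ _ tM] := HM t t01 ts.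
    by rewrite (le_trans tM)// (le_trans (ler_norm M))// lerDl.
  rewrite (le_trans (_ : _ <= \sum_(x <- [:: 0, 1 & s]) N x))//; last by rewrite lerDr.
  rewrite (perm_big _ (perm_to_rem tZ)) big_cons lerDl.
  by apply: sumr_ge0 => x _; exact: normr_ge0.
have iN : (@lebesgue_measure R).-integrable (`[0%R, 1%R] : set R) (EFin \o N).
  apply: measurable_bounded_integrable => //.
  by rewrite /= lebesgue_measure_itv/= lte01 sube0 ltry.
pose S t := (\int[lebesgue_measure]_(x in `[0%R, t]) N x)%R.
exists S, s; split; last first.
  rewrite LN /S /Rintegral fineK//.
  exact: integrable_fin_num iN.
split.
- exact: (parameterized_integral_continuous ler01 iN).
- by rewrite /S set_itv1 Rintegral_set1.
- move=> t t01 ts; have [dt ct _] := HM t t01 ts.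
  split; first exact: (DeriveDef dt (esym (derive1E _ _))).
  move: (t01); rewrite in_itv/= => /andP[t0 t1].
  have [|dS SE] := @continuous_FTC1_closed R N 0 t 1 t1 iN t0.
    exact: cvg_norm ct.
  exact: (DeriveDef dS (etrans (esym (derive1E _ _)) SE)).
Qed.

End PathLength.

(** * Angular speed *)

Section Angle.
Context {R : realType}.

(** The hypothesis says that [arcsin h] has derivative at most [S']. *)
Lemma asin_rate_le (s : seq R) (h S : R -> R) (a b : R) : a <= b ->
  {within `[a, b], continuous h} -> {within `[a, b], continuous S} ->
  (forall t, t \in `[a, b] -> `|h t| < 1) ->
  (forall t : R, t \in `]a, b[ -> t \notin s -> exists h' S',
    [/\ is_derive t 1 h h', is_derive t 1 S S', 0 <= S'
      & h' ^+ 2 <= S' ^+ 2 * (1 - h t ^+ 2)]) ->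
  asin (h b) - asin (h a) <= S b - S a.
Proof.
move=> ab ch cS h1 dh.
have h1' t : t \in `[a, b] -> -1 < h t < 1 by move=> /h1; rewrite ltr_norml.
suff : asin (h b) - S b <= asin (h a) - S a by lra.
apply: (@le_of_derive_off_finite _ s (fun t => asin (h t) - S t)) => //.
  have cah : {within `[a, b], continuous (fun t => asin (h t))}.
    rewrite continuous_subspace_in => t /set_mem tab.
    by apply: continuous_comp; [exact: ch|exact/continuous_asin/h1'].
  by move=> t; apply: cvgB; [exact: cah|exact: cS].
move=> t tab ts; have [h' [S' [dht dSt S0 hS]]] := dh t tab ts.
have htI : -1 < h t < 1.
  by apply: h1'; move: tab; rewrite !in_itv/= => /andP[/ltW -> /ltW ->].
have da : is_derive t 1 (fun t => asin (h t)) ((Num.sqrt (1 - h t ^+ 2))^-1 * h').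
  exact: is_derive1_comp.
exists ((Num.sqrt (1 - h t ^+ 2))^-1 * h' - S'); first exact: is_deriveB.
have q0 : 0 < 1 - h t ^+ 2.
  by rewrite subr_gt0 -real_normK ?num_real// expr_lt1//; rewrite ltr_norml.
have r0 : 0 < Num.sqrt (1 - h t ^+ 2) by rewrite sqrtr_gt0.
rewrite subr_le0 ler_pdivrMl// (le_trans (ler_norm _))//.
rewrite -(@ler_pXn2r _ 2) ?nnegrE ?mulr_ge0 ?(ltW r0)// real_normK ?num_real//.
by rewrite exprMn sqr_sqrtr ?(ltW q0)// mulrC.
Qed.

Context {E : normedModType R}.
Implicit Types (g m : blin E E) (f : dual E).

Fact dual_comp_subproof f m : (f \o m : E -> R^o) \in @blin_pred R E R^o.
Proof.
apply/asboolP; split; first by move=> a x y /=; rewrite !blin_linear.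
exists (`|f| * `|m|) => x /=; rewrite -mulrA.
by apply: (le_trans (ler_blin _ _)); apply: ler_wpM2l => //; exact: ler_blin.
Qed.

Definition dual_comp f m : dual E := BLin (dual_comp_subproof f m).

Lemma dual_comp_norm f m : `|m| <= 1 -> `|dual_comp f m| <= `|f|.
Proof.
move=> m1; apply: blin_norm_le => // x.
apply: (le_trans (ler_blin f (m x))); apply: ler_wpM2l => //.
by apply: (le_trans (ler_blin m x)); rewrite ler_piMl.
Qed.

(** Functionals of norm strictly less than 1 are used because [arcsin] is
    differentiable in the open interval only; by [blin_norm_le_dual_lt] they
    suffice to compute norms. *)
Definition angle_le g g' (l : R) := forall f x, `|f| < 1 -> `|x| <= 1 ->
  asin (f (g' x) : R) - asin (f (g x) : R) <= l.

Lemma angle_le_trans g1 g2 g3 l l' :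
  angle_le g1 g2 l -> angle_le g2 g3 l' -> angle_le g1 g3 (l + l').
Proof. by move=> H H' f x f1 x1; have := H f x f1 x1; have := H' f x f1 x1; lra. Qed.

Lemma angle_le_mul m n g g' l : `|m| <= 1 -> `|n| <= 1 -> angle_le g g' l ->
  angle_le (bcomp m (bcomp g n)) (bcomp m (bcomp g' n)) l.
Proof.
move=> m1 n1 H f x f1 x1; apply: (H (dual_comp f m) (n x)).
  exact: le_lt_trans (dual_comp_norm _ m1) f1.
by rewrite (le_trans (ler_blin1 n x1)).
Qed.

Lemma blin_norm_le_dual_lt g (c : R) :
  (forall f x, `|f| < 1 -> `|x| <= 1 -> f (g x) <= c) -> `|g| <= c.
Proof.
move=> H; apply: blin_norm_le_dual => f x f1 x1; rewrite leNgt; apply/negP => cf.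
have [e /andP[e0 e1'] He] : exists2 e : R, 0 < e < 1 & c < (1 - e) * (f (g x) : R).
  pose y : R := f (g x).
  have y1 : 0 < `|y| + 1 by rewrite ltr_wpDl.
  have yc : 0 < y - c by rewrite subr_gt0.
  exists (Num.min 2^-1 ((y - c) / (2 * (`|y| + 1)))).
    rewrite lt_min invr_gt0 ltr0n divr_gt0 ?mulr_gt0//= gt_min.
    by rewrite invf_lt1 ?ltr1n.
  have : Num.min 2^-1 ((y - c) / (2 * (`|y| + 1))) * y <= (y - c) / 2.
    apply: le_trans (ler_norm _) _; rewrite normrM ger0_norm; last first.
      by rewrite le_min invr_ge0 ler0n divr_ge0 ?mulr_ge0 ?(ltW yc) ?(ltW y1).
    apply: (@le_trans _ _ ((y - c) / (2 * (`|y| + 1)) * (`|y| + 1))).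
      rewrite ler_pM ?le_min ?invr_ge0 ?ler0n ?divr_ge0 ?mulr_ge0 ?(ltW yc) ?(ltW y1)//.
        by rewrite ge_min lexx orbT.
      by rewrite lerDl.
    by rewrite le_eqVlt; apply/orP; left; apply/eqP; field; rewrite gt_eqF.
  rewrite -/y; lra.
have e1 : 0 < 1 - e by lra.
have fe : `|(1 - e) *: f| < 1.
  rewrite normrZ gtr0_norm//.
  have := ler_wpM2l (ltW e1) f1; lra.
have := H _ x fe x1; rewrite blinZE; apply/negP; rewrite -ltNge.
by move: He; rewrite [_ *: f (g x)]/(_ * _).
Qed.

Lemma sin_dist_le (x y : R) : x <= y -> sin y - sin x <= y - x.
Proof.
move=> xy; suff : sin y - y <= sin x - x by lra.
apply: (@le_of_derive_off_finite _ [::] (fun t => sin t - t)) => //.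
  apply: derivable_within_continuous => t _; apply: derivableB => //.
move=> t _ _; exists (cos t - 1); last by rewrite subr_le0 cos_le1.
exact: is_deriveB.
Qed.

(** The sine is 1-Lipschitz. *)
Lemma angle_le_norm g g' l : `|g| <= 1 -> `|g'| <= 1 -> 0 <= l ->
  angle_le g g' l -> `|g' - g| <= l.
Proof.
move=> g1 g'1 l0 H; apply: blin_norm_le_dual_lt => f x f1 x1.
rewrite blinBE blinB.
have bd m : `|m| <= 1 -> -1 <= (f (m x) : R) <= 1.
  move=> m1; rewrite -ler_norml; apply: (dual_le1 (ltW f1)).
  exact: le_trans (ler_blin1 m x1) m1.
have eu : sin (asin (f (g x) : R)) = f (g x) by apply: asinK; rewrite in_itv/= bd.
have ev : sin (asin (f (g' x) : R)) = f (g' x) by apply: asinK; rewrite in_itv/= bd.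
rewrite -eu -ev; have := H f x f1 x1.
have := bd _ g1; have := bd _ g'1 => b' b.
have := conj (asin_geNpi2 b) (asin_lepi2 b).
have := conj (asin_geNpi2 b') (asin_lepi2 b').
move: (asin (f (g x) : R)) (asin (f (g' x) : R)) => u v [v1 v2] [u1 u2] uv.
have [vu|/ltW uv'] := leP u v; first exact: le_trans (sin_dist_le vu) uv.
apply: le_trans l0; rewrite subr_le0.
by rewrite leNgt ltr_sin ?in_itv/= ?u1 ?v1// -leNgt.
Qed.

End Angle.

Section PathAngle.
Context {R : realType} {V : jbAlgebraType R}.
Implicit Types (gamma : R -> blin V V).

Lemma jmul_cvg {T} (G : set_system T) {FG : Filter G} (u v : T -> V) (a b : V) :
  u @ G --> a -> v @ G --> b -> jmul (u t) (v t) @[t --> G] --> jmul a b.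
Proof. exact: (bilin_cvg jmul_linl jmul_linear jnormM). Qed.

Lemma quotient_cvg0 {E : normedModType R} (c : R -> E) (t : R) (w : E)
    (G : set_system R) {FG : Filter G} :
  G --> 0^' -> u^-1 *: (c (u + t) - c t) @[u --> G] --> w ->
  c (u + t) @[u --> G] --> c t.
Proof.
move=> G0 cw.
have G0' : (fun u : R => u) @ G --> (0 : R).
  by move=> A A0; apply: G0; exact: cvg_within.
have cv : u *: (u^-1 *: (c (u + t) - c t)) @[u --> G] --> 0 *: w.
  exact: cvgZ.
rewrite scale0r in cv; apply/subr_cvg0; apply: cvg_trans cv; apply: near_eq_cvg.
apply: G0; near=> u; rewrite scalerA divff ?scale1r//.
by near: u; exact: nbhs_dnbhs_neq.
Unshelve. all: by end_near. Qed.

(** Divide [k (a o b) = k a o k b] at [gamma (u + t)] and at [gamma t] by [u] and let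
    [u] tend to 0. With [G] a one-sided neighbourhood of 0 this covers the velocities
    at the ends and at the break points of a path. *)
Lemma quotient_der gamma (t : R) (w : blin V V) (G : set_system R) {FG : ProperFilter G} :
  G --> 0^' -> Aut V (gamma t) -> (\forall u \near G, Aut V (gamma (u + t))) ->
  u^-1 *: (gamma (u + t) - gamma t) @[u --> G] --> w ->
  exists A : der V, bcomp (binv (gamma t)) w = A.
Proof.
move=> G0 At Ag gw; have FF : Filter G by exact: filter_filter.
have gt := quotient_cvg0 (FG := FF) G0 gw.
have wM a b : w (jmul a b) = jmul (w a) (gamma t b) + jmul (gamma t a) (w b).
  have l := blin_eval_cvg (FG := FF) (jmul a b) gw.
  have r : jmul ((u^-1 *: (gamma (u + t) - gamma t)) a) (gamma (u + t) b) +
      jmul (gamma t a) ((u^-1 *: (gamma (u + t) - gamma t)) b) @[u --> G] -->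
      jmul (w a) (gamma t b) + jmul (gamma t a) (w b).
    have r1 := jmul_cvg (FG := FF) (blin_eval_cvg (FG := FF) a gw) (blin_eval_cvg (FG := FF) b gt).
    have rc : (fun _ : R => gamma t a) @ G --> gamma t a by exact: cvg_cst.
    have r2 := jmul_cvg (FG := FF) rc (blin_eval_cvg (FG := FF) b gw).
    exact: (cvgD r1 r2).
  apply: (cvg_unique (@norm_hausdorff _ _) l).
  apply: cvg_trans r; apply: near_eq_cvg; apply: filterS Ag => u [_ _ uM].
  have [_ _ tM] := At.
  rewrite !blinZE !blinBE uM tM.
  by rewrite jmulZl jmulZr -scalerDr jmulBl jmulBr addrA subrK.
have AD : bcomp (binv (gamma t)) w \in @derivation_pred R V.
  apply/asboolP => x y; have [_ _ iM] := autV At.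
  by rewrite /= wM blinD !iM !(autK _ At).
by exists (Der AD).
Qed.

Lemma zero_flow (E : completeNormedModType R) : isometric_flow (0 : blin E E).
Proof. by move=> t; rewrite /flow scaler0 bexp0 bid_norm. Qed.

Lemma near_path_Aut gamma (t : R) : (forall t : R, t \in `[0, 1] -> Aut V (gamma t)) ->
  t \in `]0, 1[ -> \forall u \near 0^', Aut V (gamma (u + t)).
Proof.
move=> Ag t01; apply: cvg_within.
have tt : (fun u : R => u + t) @ (0 : R) --> 0 + t.
  by apply: cvgD; [exact: cvg_id|exact: cvg_cst].
rewrite add0r in tt; apply: (tt [set s | Aut V (gamma s)]); apply: filterS (near_in_itvoo t01) => u.
by rewrite in_itv/= => /andP[/ltW u0 /ltW u1]; apply: Ag; rewrite in_itv/= u0.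
Qed.

(** The derivative of [f (gamma_t x)] is [(f \o gamma_t) (A x)] for a derivation
    [A] of norm [|gamma_t'|], to which [flow_rate] applies because [f \o gamma_t]
    is not longer than [f]. *)
Lemma path_angle gamma S s (a b : R) :
  (forall t : R, t \in `[0, 1] -> Aut V (gamma t)) ->
  {within `[0, 1], continuous gamma} -> arc_length S s gamma ->
  0 <= a -> a <= b -> b <= 1 -> angle_le (gamma a) (gamma b) (S b - S a).
Proof.
move=> Ag cg [cS S0 dS] a0 ab b1 f x f1 x1.
have sub t : t \in `[a, b] -> t \in `[0, 1].
  by rewrite !in_itv/= => /andP[ta tb]; rewrite (le_trans a0 ta) (le_trans tb b1).
apply: (@asin_rate_le _ s (fun t => f (gamma t x)) S) => //.
- move=> t; apply: (blin_cvg f); apply: blin_eval_cvg.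
  exact: sub_itv_cont a0 b1 cg t.
- exact: (@sub_itv_cont _ R^o S 0 1 a b).
- move=> t /sub /Ag /aut_isometric gi.
  by rewrite (le_lt_trans (ler_blin1 f _))// gi.
move=> t tab ts.
have t01 : t \in `]0, 1[.
  by move: tab; rewrite !in_itv/= => /andP[ta tb]; rewrite (le_lt_trans a0 ta) (lt_le_trans tb b1).
have At : Aut V (gamma t) by apply: Ag; move: t01; rewrite !in_itv/= => /andP[/ltW -> /ltW ->].
have [dg dSt] := dS t t01 ts.
exists (f (derive1 gamma t x)), `|derive1 gamma t|; split=> //.
  by apply: (blin_is_derive f); exact: blin_eval_is_derive.
have [A AE] := @quotient_der gamma t (derive1 gamma t) _
  (Proper_dnbhs_numFieldType 0) (fun _ H => H) At
  (near_path_Aut Ag t01) ((is_derive1P _ _ _).1 dg).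
have gE : derive1 gamma t = bcomp (gamma t) A.
  by rewrite -AE bcompA (aut_inverse At).1 bcomp1f.
have tn : `|gamma t| <= 1 by exact: isometric_norm (aut_isometric At).
have := @flow_rate R V A 0 (bid V) (dual_comp f (gamma t)) x `|derive1 gamma t|.
rewrite (_ : dual_comp _ _ (bid V ((0 : blin V V) x)) = 0); last exact: blin0.
rewrite addr0 gE; apply => //.
- exact: der_isometric_flow.
- exact: zero_flow.
- by rewrite normr0 addr0 isometric_bcomp_norm//; exact: aut_isometric.
- exact: bid_norm.
- exact: le_trans (dual_comp_norm _ tn) (ltW f1).
Qed.

End PathAngle.

(** * Sharpness of the angle estimate *)

Section SharpAngle.
Context {R : realType} {E : completeNormedModType R}.
Implicit Types (X Q : blin E E) (f : dual E).

(** When [f (X x)] is close to [|X|] the angle [b] is close to [- pi / 2]. The function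
    [- f (e^{tX} X x) / |X|] starts at [sin b] and by [flow_rate] its angle grows at
    speed at most [|X|]. So the derivative of [f (e^{tX} x)] is at least
    [- |X| sin (b + t |X|)], which is integrated over [0, 1]; the value at [t = 0] is
    controlled by [flow_rate] once more. *)
Lemma flow_angle_lower X f x (b : R) : isometric_flow X -> 0 < `|X| < pi / 2 ->
  `|f| < 1 -> `|x| <= 1 -> - (pi / 2) <= b <= 0 -> f (X x) = - `|X| * sin b :> R ->
  (f x : R) <= cos b /\ cos (b + `|X|) - 2 * cos b <= f (bexp X x).
Proof.
move=> iX /andP[]; set r := `|X| => r0 rpi f1 x1 /andP[b1 b2] fXx.
have [sN1 s1] : -1 <= sin b /\ sin b <= 1 by rewrite sin_geN1 sin_le1.
have cb : 0 <= cos b by apply: cos_ge0_pihalf; rewrite b1 (le_trans b2)// divr_ge0// pi_ge0.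
have sc : sin b ^+ 2 = 1 - cos b ^+ 2 by rewrite -sin2cos2.
have bid1 := @bid_norm R E.
have rate (m : blin E E) y : `|m| <= 1 -> `|y| <= 1 ->
    (f (m (X y)) : R) ^+ 2 <= r ^+ 2 * (1 - (f (m y) : R) ^+ 2).
  move=> m1 y1; have := @flow_rate R E 0 X m f y r (@zero_flow _ E) iX.
  rewrite (_ : f ((0 : blin E E) (m y)) = 0); last by rewrite blin0E blin0.
  by rewrite add0r normr0 add0r; apply => //; exact: ltW.
have h0 : `|f x : R| <= cos b.
  have := rate _ _ bid1 x1; rewrite !bidE fXx exprMn sqrrN ler_pM2l ?exprn_gt0//.
  rewrite sc => H; rewrite -(@ler_pXn2r _ 2) ?nnegrE// real_normK ?num_real//; lra.
have h0' := h0; rewrite ler_norml in h0'; case/andP: h0' => h0l h0r; split=> //.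
pose p t : R := - (r^-1 * f (flow X t (X x))).
have dfl y (t : R) : is_derive t 1 (fun t => f (flow X t y)) (f (flow X t (X y))).
  have := blin_is_derive f (blin_eval_is_derive y (flow_is_derive X t)).
  by rewrite -flow_comm.
have xr : `|r^-1 *: X x| <= 1.
  rewrite normrZ gtr0_norm ?invr_gt0// mulrC ler_pdivrMr// mul1r.
  exact: ler_blin1.
have pE t : p t = - (f (flow X t (r^-1 *: X x)) : R) by rewrite /p !blinZ.
have dp (t : R) : is_derive t 1 p (- (f (flow X t (X (r^-1 *: X x))) : R)).
  rewrite (_ : p = fun t => - (f (flow X t (r^-1 *: X x)) : R)); last exact/funext.
  exact: (@is_deriveN _ _ _ (fun t => f (flow X t (r^-1 *: X x)) : R) t 1 _ (dfl _ t)).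
have p1 t : `|p t| < 1.
  rewrite pE normrN (le_lt_trans (ler_blin1 f _))//.
  exact: le_trans (ler_blin1 _ xr) (iX t).
have contR (F F' : R -> R) a c : (forall t : R, is_derive t 1 F (F' t)) ->
    {within `[a, c], continuous F}.
  by move=> dF; apply: derivable_within_continuous => t _; have [] := dF t.
have dlin (t : R) : is_derive t 1 (fun t : R => r * t) r.
  by apply: is_derive_eq; rewrite /GRing.scale/= mulr1.
have ple t : 0 <= t -> asin (p t) <= b + r * t.
  move=> t0; have p0 : p 0 = sin b.
    by rewrite /p flow0 bidE fXx mulNr mulrN opprK mulKf// gt_eqF.
  have -> : b = asin (p 0) by rewrite p0 sinK// in_itv/= b1 (le_trans b2)// divr_ge0// pi_ge0.
  rewrite -lerBlDl -[leRHS]subr0 -[in leRHS](mulr0 r).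
  apply: (@asin_rate_le _ [::] p (fun t => r * t)) => //.
  - exact: contR dp.
  - exact: contR dlin.
  move=> s _ _; exists (- (f (flow X s (X (r^-1 *: X x))) : R)), r; split=> //.
    exact: ltW.
  rewrite pE !sqrrN; apply: rate => //.
have fXe t : 0 <= t -> t <= 1 -> - (r * sin (b + r * t)) <= f (flow X t (X x)).
  move=> t0 t1; have rt : r * t <= r by rewrite ger_pMr.
  have rt0 : 0 <= r * t by rewrite mulr_ge0// ltW.
  have pt := ple t t0; have pI : -1 <= p t <= 1 by rewrite -ler_norml ltW.
  have : p t <= sin (b + r * t).
    rewrite -[leLHS](asinK (_ : p t \in `[(-1), 1])) ?in_itv//=.
    rewrite leNgt ltr_sin ?in_itv/= -?leNgt// ?asin_geNpi2 ?asin_lepi2//.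
    by apply/andP; split; lra.
  rewrite /p -(ler_pM2l r0) mulrN mulrA divff ?gt_eqF// mul1r; lra.
have := @le_of_derive_off_finite _ [::]
  (fun t => cos (b + r * t) - (f (flow X t x) : R)) 0 1 ler01.
rewrite mulr0 addr0 mulr1 flow0 bidE /flow scale1r => H.
suff : cos (b + r) - (f (bexp X x) : R) <= cos b - (f x : R) by lra.
have dF (t : R) : is_derive t 1 (fun t => cos (b + r * t) - (f (flow X t x) : R))
    (- sin (b + r * t) * r - (f (flow X t (X x)) : R)).
  have dc : is_derive t 1 (fun t : R => cos (b + r * t)) (- sin (b + r * t) * r).
    apply: is_derive1_comp.
    by have := is_deriveD (is_derive_cst b t 1) (dlin t); rewrite add0r.
  exact: (@is_deriveB _ _ _ _ (fun t => f (flow X t x) : R) t 1 _ _ dc (dfl x t)).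
apply: H; first exact: contR dF.
move=> t; rewrite in_itv/= => /andP[t0 t1] _.
exists (- sin (b + r * t) * r - (f (flow X t (X x)) : R)).
  exact: dF.
have := fXe t (ltW t0) (ltW t1); lra.
Qed.

Lemma asin_ge (u y : R) : - (pi / 2) <= u <= pi / 2 -> -1 <= y <= 1 -> sin u <= y -> u <= asin y.
Proof.
move=> uI yI; rewrite -{1}(asinK (_ : y \in `[(-1), 1])) ?in_itv//=.
by rewrite leNgt ltr_sin ?in_itv/= -?leNgt// asin_geNpi2 ?asin_lepi2.
Qed.

Lemma asin_le (u y : R) : - (pi / 2) <= u <= pi / 2 -> -1 <= y <= 1 -> y <= sin u -> asin y <= u.
Proof.
move=> uI yI; rewrite -{1}(asinK (_ : y \in `[(-1), 1])) ?in_itv//=.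
by rewrite leNgt ltr_sin ?in_itv/= -?leNgt// asin_geNpi2 ?asin_lepi2.
Qed.

Lemma sin_le_id (x : R) : 0 <= x -> sin x <= x.
Proof. by move=> x0; have := sin_dist_le x0; rewrite sin0 !subr0. Qed.

(** The bounds of [flow_angle_lower] tend to [0] and to [sin |X|] as [b] tends to
    [- pi / 2], and [arcsin] inverts the sine up to [pi / 2]. *)
Lemma sharp_angle X (e : R) : isometric_flow X -> 0 < `|X| < pi / 2 -> 0 < e <= `|X| ->
  exists2 d : R, 0 < d & forall f x, `|f| < 1 -> `|x| <= 1 ->
    `|X| - d < f (X x) ->
    [/\ `|X| - e <= asin (f (bexp X x) : R), asin (f x : R) <= e & (f x : R) <= e].
Proof.
move=> iX rI /andP[e0 er]; have /andP[] := rI; set r := `|X| in rI er * => r0 rpi.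
have pi0 := pi_gt0 R.
have re : 0 <= r - e by lra.
pose B : set R := [set b | sin (r - e) < cos (b + r) - 2 * cos b /\ cos b < sin e].
have cc : continuous (@cos R) by exact: continuous_cos.
have nB : nbhs (- (pi / 2) : R) B.
  have cs : (fun b : R => b + r) @ (- (pi / 2) : R) --> - (pi / 2) + r.
    by apply: cvgD; [exact: cvg_id|exact: cvg_cst].
  have c1 : (fun b : R => cos (b + r) - 2 * cos b) @ (- (pi / 2) : R) -->
      cos (- (pi / 2) + r) - 2 * cos (- (pi / 2)).
    apply: cvgB; first exact: (@cvg_comp _ _ _ _ (@cos R) _ _ _ cs (cc _)).
    by apply: cvgM; [exact: cvg_cst|exact: cc].
  apply: filterI.
    apply: (cvgr_gt _ c1).
    have -> : cos (- (pi / 2) + r) = sin r by rewrite addrC -sinDpihalf subrK.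
    rewrite cosN cos_pihalf mulr0 subr0.
    by rewrite ltr_sin ?in_itv/=; [lra|apply/andP; split; lra..].
  apply: (cvgr_lt _ (cc (- (pi / 2)))).
  by rewrite cosN cos_pihalf sin_gt0_pihalf// e0; lra.
have [d /= d0 dB] := nB.
pose b0 := - (pi / 2) + Num.min (d / 2) (pi / 2).
have b0pi : - (pi / 2) < b0 by rewrite ltrDl lt_min !divr_gt0.
have b00 : b0 <= 0 by rewrite /b0 -lerBrDl sub0r opprK ge_min lexx orbT.
have b0d : b0 + pi / 2 <= d / 2.
  by rewrite /b0 addrAC addNr add0r ge_min lexx.
have sb0 : -1 < sin b0.
  by rewrite -(sin_pihalf R) -sinN ltr_sin// in_itv/=; apply/andP; split; lra.
exists (r * (1 + sin b0)); first by rewrite mulr_gt0//; lra.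
move=> f x f1 x1 fX.
have fXr : `|f (X x) : R| <= r.
  apply: (le_trans (ler_blin f _)); apply: (le_trans (ler_piMl _ (ltW f1))) => //.
  exact: ler_blin1.
pose y : R := - (r^-1 * f (X x)).
have y1 : -1 <= y <= 1.
  by rewrite -ler_norml normrN normrM gtr0_norm ?invr_gt0// ler_pdivrMl// mulr1.
have fXE : f (X x) = - r * sin (asin y) :> R.
  by rewrite asinK ?in_itv// mulrNN mulVKf// gt_eqF.
have ylt : asin y < b0.
  rewrite -ltr_sin ?in_itv/= ?asin_geNpi2 ?asin_lepi2//; last first.
    by apply/andP; split; lra.
  rewrite -(ltr_pM2l r0); move: fX; rewrite fXE; lra.
have yN := asin_geNpi2 y1.
have [|fx eX] := flow_angle_lower iX rI f1 x1 _ fXE; first by rewrite yN; lra.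
have [|B1 B2] := dB (asin y).
  by rewrite /= distrC opprK ger0_norm; lra.
have xI : -1 <= (f x : R) <= 1 by rewrite -ler_norml; exact: dual_le1 (ltW f1) x1.
have eI : -1 <= (f (bexp X x) : R) <= 1.
  rewrite -ler_norml; apply: (dual_le1 (ltW f1)).
  have := iX 1; rewrite /flow scale1r; exact: le_trans (ler_blin1 _ x1).
have fe : (f x : R) <= sin e by rewrite (le_trans fx)// ltW.
split.
- apply: asin_ge => //; first by apply/andP; split; lra.
  by rewrite (le_trans _ eX)// ltW.
- by apply: asin_le => //; apply/andP; split; lra.
- by rewrite (le_trans fe)// sin_le_id// ltW.
Qed.

Lemma exists_almost_norming (T : blin E E) (c : R) : c < `|T| ->
  exists f x, [/\ `|f| < 1, `|x| <= 1 & c < f (T x)].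
Proof.
move=> cT; apply: contrapT => H; move: cT; apply/negP; rewrite -leNgt.
apply: blin_norm_le_dual_lt => f x f1 x1; rewrite leNgt; apply/negP => cf; apply: H.
by exists f, x.
Qed.

Lemma angle_le_ge0 (g g' : blin E E) (l : R) : angle_le g g' l -> 0 <= l.
Proof.
have n0 : `|0 : dual E| < 1 by rewrite normr0.
have x0 : `|0 : E| <= 1 by rewrite normr0.
by move=> /(_ 0 0 n0 x0); rewrite !blin0E subrr.
Qed.

(** Along functionals that almost norm [X], the angle increases by almost [|X|] from
    [1] to [e^X]. *)
Lemma exp_angle_ge X (l : R) : isometric_flow X -> `|X| < pi / 2 ->
  angle_le (bid E) (bexp X) l -> `|X| <= l.
Proof.
move=> iX Xpi Hl; have [X0|X0] := leP `|X| 0.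
  exact: le_trans X0 (angle_le_ge0 Hl).
apply/ler_addgt0Pr => d d0.
pose e := Num.min `|X| (d / 2).
have e0 : 0 < e by rewrite lt_min X0 divr_gt0.
have eX : 0 < e <= `|X| by rewrite e0 ge_min lexx.
have ed : e <= d / 2 by rewrite ge_min lexx orbT.
have [c c0 H] := sharp_angle iX (introT andP (conj X0 Xpi)) eX.
have [|f [x [f1 x1 fX]]] := @exists_almost_norming X (`|X| - c); first lra.
have [h1 h2 _] := H f x f1 x1 fX.
have := Hl f x f1 x1; rewrite bidE; lra.
Qed.

End SharpAngle.

Section NormingFunctionals.
Context {R : realType} {V : jbAlgebraType R}.
Implicit Types (D Z : der V) (phi : dual (der V)).

Lemma der_norm_le_dual D (c : R) :
  (forall (f : dual V) x, `|f| < 1 -> `|x| <= 1 -> f (D x) <= c) -> `|D| <= c.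
Proof. exact: blin_norm_le_dual_lt. Qed.

(** Let [phi] attain its norm at [D]; then [phi (D - s Z) <= |D - s Z|]. For small
    [s] only the pairs [(f, x)] that almost norm [D] count in the norm on the right,
    and on these [f (Z x)] is bounded below; dividing by [s] gives the bound for
    [phi]. *)
Lemma norming_ge D Z phi (c : R) : norming D phi ->
  (forall e, 0 < e <= `|D| -> exists2 d, 0 < d & forall (f : dual V) x,
    `|f| < 1 -> `|x| <= 1 -> `|D| - d < f (D x) -> c - e <= f (Z x)) ->
  0 < `|D| -> c <= phi Z.
Proof.
move=> [phi1 phiD] H D0; apply/ler_addgt0Pr => e0 e0_gt0.
pose e := Num.min `|D| e0.
have e_gt0 : 0 < e by rewrite lt_min D0.
have ee0 : e <= e0 by rewrite ge_min lexx orbT.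
have [|d d0 Hd] := H e; first by rewrite e_gt0 ge_min lexx.
pose K := `|Z| + `|c| + 1.
have K0 : 0 < K by rewrite /K; have := normr_ge0 Z; have := normr_ge0 c; lra.
(* For this [s], pairs with [f (D x) <= |D| - d] satisfy the estimate trivially. *)
pose s := d / K; have s0 : 0 < s by rewrite divr_gt0.
have sK : s * K = d by rewrite /s divfK// gt_eqF.
have key : `|D - s *: Z| <= `|D| - s * (c - e).
  apply: der_norm_le_dual => f x f1 x1.
  have -> : f ((D - s *: Z) x) = (f (D x) : R) - s * f (Z x) :> R.
    by rewrite blinBE blinB blinZE blinZ.
  have fD : (f (D x) : R) <= `|D|.
    apply: le_trans (ler_norm _) _; apply: (le_trans (ler_blin f _)).
    by apply: (le_trans (ler_piMl _ (ltW f1))) => //; exact: ler_blin1.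
  have fZ : `|f (Z x) : R| <= `|Z|.
    apply: (le_trans (ler_blin f _)).
    by apply: (le_trans (ler_piMl _ (ltW f1))) => //; exact: ler_blin1.
  have [fDd|fDd] := ltP (`|D| - d) (f (D x) : R).
    have := Hd f x f1 x1 fDd => Hf; have := ler_wpM2l (ltW s0) Hf; lra.
  have fZl : - `|Z| <= (f (Z x) : R) by move: fZ; rewrite ler_norml => /andP[].
  have cn := ler_norm c.
  have : s * (- `|Z|) <= s * f (Z x) by rewrite ler_wpM2l// ltW.
  have : s * (c - e) <= s * `|c| by rewrite ler_wpM2l ?ltW//; lra.
  rewrite -sK /K in fDd; lra.
have : phi (D - s *: Z) <= `|D| - s * (c - e) :> R.
  apply: le_trans (ler_norm _) _; apply: (le_trans (ler_blin phi _)).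
  by rewrite phi1 mul1r.
rewrite blinB blinZ phiD => H2.
have H3 : `|D| - s * (phi Z : R) <= `|D| - s * (c - e) := H2.
have : s * (c - e) <= s * (phi Z : R) by lra.
rewrite ler_pM2l//; lra.
Qed.

End NormingFunctionals.

(** * Velocities of short paths *)

Section Face.
Context {R : realType} {V : jbAlgebraType R}.
Variables (gamma : R -> blin V V) (S : R -> R) (s : seq R).
Hypothesis Ag : forall t : R, t \in `[0, 1] -> Aut V (gamma t).
Hypothesis cg : {within `[0, 1], continuous gamma}.
Hypothesis gS : arc_length S s gamma.

Let I01 (t : R) : 0 <= t -> t <= 1 -> t \in `[0, 1].
Proof. by move=> t0 t1; rewrite in_itv/= t0. Qed.

Lemma path_norm t : t \in `[0, 1] -> `|gamma t| <= 1.
Proof. by move=> /Ag /aut_isometric /isometric_norm. Qed.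

Lemma path_binv_norm t : t \in `[0, 1] -> `|binv (gamma t)| <= 1.
Proof. by move=> /Ag /autV /aut_isometric /isometric_norm. Qed.

Lemma path_increment_angle a b : 0 <= a -> a <= b -> b <= 1 ->
  angle_le (bid V) (bcomp (binv (gamma a)) (gamma b)) (S b - S a).
Proof.
move=> a0 ab b1; have aI : a \in `[0, 1] by rewrite I01// (le_trans ab).
have := angle_le_mul (path_binv_norm aI) (@bid_norm R V) (path_angle Ag cg gS a0 ab b1).
by rewrite !bcompf1 (aut_inverse (Ag aI)).2.
Qed.

(** With [k = gamma_0] and [Q] the increment over [a, b], the product [k^-1 gamma_1]
    can be reached from [Q] by moving first through [k^-1 gamma_t Q] for [t <= a],
    which ends at [k^-1 gamma_b], and then along the remaining part of the path. So
    the increment is moved to the front without being conjugated. *)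
Lemma path_complement_angle a b : 0 <= a -> a <= b -> b <= 1 ->
  angle_le (bcomp (binv (gamma a)) (gamma b)) (bcomp (binv (gamma 0)) (gamma 1))
    (S 1 - (S b - S a)).
Proof.
move=> a0 ab b1; have aI : a \in `[0, 1] by rewrite I01// (le_trans ab).
have bI : b \in `[0, 1] by rewrite I01// (le_trans a0).
have zI : (0 : R) \in `[0, 1] by rewrite I01// ler01.
have Qn : `|bcomp (binv (gamma a)) (gamma b)| <= 1.
  apply/isometric_norm/isometric_comp; first exact/aut_isometric/autV/Ag.
  exact/aut_isometric/Ag.
have H1 := angle_le_mul (path_binv_norm zI) Qn
  (path_angle Ag cg gS (lexx 0) a0 (le_trans ab b1)).
rewrite !bcompA (aut_inverse (Ag zI)).2 bcomp1f -(bcompA (binv (gamma 0))) in H1.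
rewrite -!bcompA (bcompA (gamma a)) (aut_inverse (Ag aI)).1 bcomp1f in H1.
have H2 := angle_le_mul (path_binv_norm zI) (@bid_norm R V)
  (path_angle Ag cg gS (le_trans a0 ab) b1 (lexx 1)).
rewrite !bcompf1 in H2.
have := angle_le_trans H1 H2; have [_ S0 _] := gS; rewrite S0.
by rewrite (_ : S a - 0 + (S 1 - S b) = S 1 - (S b - S a))//; ring.
Qed.

Lemma arc_length_mono a b : 0 <= a -> a <= b -> b <= 1 -> S a <= S b.
Proof.
by move=> a0 ab b1; rewrite -subr_ge0; exact: angle_le_ge0 (path_angle Ag cg gS a0 ab b1).
Qed.

Lemma path_increment_norm a b : 0 <= a -> a <= b -> b <= 1 ->
  `|gamma b - gamma a| <= S b - S a.
Proof.
move=> a0 ab b1; apply: angle_le_norm; last exact: path_angle Ag cg gS a0 ab b1.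
- by apply: path_norm; rewrite I01// (le_trans ab).
- by apply: path_norm; rewrite I01// (le_trans a0).
- by rewrite subr_ge0 arc_length_mono.
Qed.

Variables (D : der V) (phi : dual (der V)).
Hypothesis gD : bcomp (binv (gamma 0)) (gamma 1) = bexp D.
Hypothesis S1 : S 1 = `|D|.
Hypothesis Dpi : `|D| < pi / 2.
Hypothesis phiD : norming D phi.

(** If [f (D x)] is almost [|D|] then the angle of [f (e^D x)] is almost [|D|], of which
    the complement of the increment [Q] over [a, b] accounts for at most
    [|D| - l], where [l] is the length over [a, b]. So [f (Q x)] is almost
    [sin l] at least, while [f x] is almost 0 at most, and [norming_ge] applies. *)
Lemma norming_increment a b (Z : der V) : 0 < `|D| -> 0 <= a -> a <= b -> b <= 1 ->
  sin `|bcomp (binv (gamma a)) (gamma b) - bid V| -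
    `|bcomp (binv (gamma a)) (gamma b) - bid V - Z| <= phi Z.
Proof.
move=> D0 a0 ab b1; set Q := bcomp _ _; set l := S b - S a.
have l0 : 0 <= l by rewrite subr_ge0 arc_length_mono.
have aI : a \in `[0, 1] by rewrite I01// (le_trans ab).
have bI : b \in `[0, 1] by rewrite I01// (le_trans a0).
have lr : l <= `|D|.
  have [_ S0 _] := gS; rewrite -S1 /l.
  have := arc_length_mono (le_trans a0 ab) b1 (lexx 1).
  have := arc_length_mono (lexx 0) a0 (le_trans ab b1); rewrite S0; lra.
have Qn : `|Q| <= 1.
  apply/isometric_norm/isometric_comp; first exact/aut_isometric/autV/Ag.
  exact/aut_isometric/Ag.
have Q1 := path_increment_angle a0 ab b1.
have Ql : `|Q - bid V| <= l := angle_le_norm (@bid_norm R V) Qn l0 Q1.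
have H3' := path_complement_angle a0 ab b1; rewrite gD S1 -/l -/Q in H3'.
have pi0 := pi_gt0 R; move: Dpi => Dpi'; clearbody l.
apply: (@le_trans _ _ (sin l - `|Q - bid V - Z|)).
  have Qge := normr_ge0 (Q - bid V).
  by rewrite lerB// leNgt ltr_sin ?in_itv/= -?leNgt//; apply/andP; split; lra.
apply: (norming_ge phiD) => // e /andP[e0 er].
have e2 : 0 < e / 2 <= `|D : blin V V| by apply/andP; split; move: er; rewrite ?der_norm_op; lra.
have [d d0 Hd] := sharp_angle (der_isometric_flow D) (introT andP (conj D0 Dpi)) e2.
exists d => // f x f1 x1 fD; have [H1 _ H2] := Hd f x f1 x1 fD.
have H3 := H3' f x f1 x1.
have QI : -1 <= (f (Q x) : R) <= 1.
  rewrite -ler_norml; apply: (dual_le1 (ltW f1)).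
  exact: le_trans (ler_blin1 Q x1) Qn.
have H4 : l - e / 2 <= asin (f (Q x) : R) by move: H1; rewrite der_norm_op in H3 *; lra.
have H5 : sin (l - e / 2) <= f (Q x).
  rewrite -[leRHS](asinK (_ : (f (Q x) : R) \in `[(-1), 1])) ?in_itv//=.
  rewrite leNgt ltr_sin ?in_itv/= -?leNgt// ?asin_geNpi2 ?asin_lepi2//.
  by apply/andP; split; lra.
have H6 : sin l - e / 2 <= sin (l - e / 2).
  have := @sin_dist_le R (l - e / 2) l; rewrite (_ : l - (l - e / 2) = e / 2); last ring.
  by move=> H; have := H ltac:(lra); lra.
have H7 : (f (Q x) : R) - f x - f (Z x) <= `|Q - bid V - Z|.
  rewrite -[leLHS]/((f (Q x)) - f (bid V x) - f (Z x) : R^o) -!blinB.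
  apply: le_trans (ler_norm _) _; apply: (le_trans (ler_blin f _)).
  apply: (le_trans (ler_piMl _ (ltW f1))) => //.
  exact: (ler_blin1 (Q - bid V - Z) x1).
lra.
Qed.

End Face.

Section SinLower.
Context {R : realType}.

Lemma cos_ge (x : R) : 0 <= x -> 1 - x <= cos x.
Proof.
move=> x0; suff : - cos x - x <= - cos 0 - 0 by rewrite cos0; lra.
have dF (t : R) : is_derive t 1 (fun t : R => - cos t - t) (- - sin t - 1).
  by apply: is_deriveB; apply: is_deriveN.
apply: (@le_of_derive_off_finite _ [::] (fun t => - cos t - t)) => //.
  by apply: derivable_within_continuous => t _; have [] := dF t.
by move=> t _ _; exists (- - sin t - 1) => //; rewrite opprK subr_le0 sin_le1.
Qed.

Lemma sin_ge (x : R) : 0 <= x -> x - x ^+ 2 / 2 <= sin x.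
Proof.
move=> x0; suff : x - x ^+ 2 / 2 - sin x <= 0 - 0 ^+ 2 / 2 - sin 0.
  by rewrite sin0 expr0n/= mul0r !subr0; lra.
have dF (t : R) : is_derive t 1 (fun t : R => t - t ^+ 2 / 2 - sin t) (1 - t - cos t).
  by apply: is_derive_eq; rewrite /GRing.scale/=; field.
apply: (@le_of_derive_off_finite _ [::] (fun t : R => t - t ^+ 2 / 2 - sin t)) => //.
  by apply: derivable_within_continuous => t _; have [] := dF t.
move=> t; rewrite in_itv/= => /andP[t0 _] _; exists (1 - t - cos t) => //.
by have := cos_ge (ltW t0); lra.
Qed.

Lemma at_right_dnbhs : (0 : R)^'+ --> (0 : R)^'.
Proof. by move=> P [e /= e0 H]; exists e => //= x xe x0; apply: H => //; rewrite gt_eqF. Qed.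

Lemma at_left_dnbhs : (0 : R)^'- --> (0 : R)^'.
Proof. by move=> P [e /= e0 H]; exists e => //= x xe x0; apply: H => //; rewrite lt_eqF. Qed.

Lemma dnbhs_nbhs : (0 : R)^' --> (0 : R).
Proof. by move=> P; exact: cvg_within. Qed.

End SinLower.

Section FaceVelocity.
Context {R : realType} {V : jbAlgebraType R}.

(** A first order expansion of the hypothesis as [tau] tends to 0. *)
Lemma norming_limit (phi : dual (der V)) (A : der V) (q : R -> blin V V) (tau : R -> R)
    (G : set_system R) {FG : ProperFilter G} :
  tau @ G --> (0 : R) -> q @ G --> (A : blin V V) ->
  (\forall u \near G, 0 < tau u /\ forall Z : der V,
    sin `|tau u *: q u| - `|tau u *: q u - Z| <= phi Z) ->
  `|A| <= phi A.
Proof.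
move=> t0 qA H.
have FF : Filter G by exact: filter_filter.
have cv : `|q u| - tau u * `|q u| ^+ 2 / 2 - `|q u - A| @[u --> G] -->
    `|A : blin V V| - 0 * `|A : blin V V| ^+ 2 / 2 - `|(A : blin V V) - A|.
  have nq : `|q u| @[u --> G] --> `|A : blin V V| by exact: cvg_norm.
  apply: cvgB; last by apply: cvg_norm; apply: cvgB => //; exact: cvg_cst.
  apply: cvgB => //; apply: cvgM; last exact: cvg_cst.
  by apply: cvgM => //; rewrite expr2; apply: cvgM.
rewrite !mul0r subrr normr0 !subr0 in cv.
apply: (closed_cvg (fun y => y <= (phi A : R)) _ _ _ cv); first exact: closed_le.
apply: filterS H => u [u0 Hu].
have : sin `|tau u *: q u| - `|tau u *: q u - tau u *: (A : blin V V)| <= tau u * (phi A : R).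
  by have := Hu (tau u *: A); rewrite blinZ.
rewrite -scalerBr !normrZ gtr0_norm// => H1.
have x0 : 0 <= tau u * `|q u| by rewrite mulr_ge0// ltW.
have H2 := sin_ge x0.
have : tau u * (`|q u| - tau u * `|q u| ^+ 2 / 2 - `|q u - A|) <= tau u * (phi A : R) by lra.
by rewrite ler_pM2l.
Qed.

Variables (gamma : R -> blin V V) (S : R -> R) (s : seq R).
Hypothesis Ag : forall t : R, t \in `[0, 1] -> Aut V (gamma t).
Hypothesis cg : {within `[0, 1], continuous gamma}.
Hypothesis gS : arc_length S s gamma.

Let I01 (t : R) : 0 <= t -> t <= 1 -> t \in `[0, 1].
Proof. by move=> t0 t1; rewrite in_itv/= t0. Qed.

Lemma near_right (t : R) : t \in `[0, 1] -> t < 1 ->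
  \forall u \near 0^'+, [/\ 0 < u, 0 <= t, t <= u + t & u + t <= 1].
Proof.
rewrite in_itv/= => /andP[t0 _] t1; near=> u.
have u0 : 0 < u by near: u; exact: nbhs_right_gt.
split=> //; first by rewrite lerDr ltW.
by rewrite -lerBrDr; near: u; apply: nbhs_right_le; rewrite subr_gt0.
Unshelve. all: by end_near. Qed.

Lemma near_left (t : R) : t \in `[0, 1] -> 0 < t ->
  \forall u \near 0^'-, [/\ u < 0, 0 <= u + t, u + t <= t & t <= 1].
Proof.
rewrite in_itv/= => /andP[_ t1] t0; near=> u.
have u0 : u < 0 by near: u; exact: nbhs_left_lt.
split=> //; last by rewrite gerDr ltW.
by rewrite -lerBlDr sub0r; near: u; apply: nbhs_left_ge; rewrite oppr_lt0.
Unshelve. all: by end_near. Qed.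

Lemma velocity_der (t : R) w : t \in `[0, 1] -> velocity gamma t w ->
  exists A : der V, bcomp (binv (gamma t)) w = A.
Proof.
move=> tI [[t1 gw]|[t0 gw]].
  apply: (@quotient_der _ _ gamma t w 0^'+ _ at_right_dnbhs (Ag tI) _ gw).
  apply: filterS (near_right tI t1) => u [u0 t0 tu u1].
  by apply: Ag; rewrite I01// (le_trans t0).
apply: (@quotient_der _ _ gamma t w 0^'- _ at_left_dnbhs (Ag tI) _ gw).
apply: filterS (near_left tI t0) => u [u0 ut tu t1].
by apply: Ag; rewrite I01// (le_trans tu).
Qed.

Lemma velocity_eq0 (t : R) w : S 1 = 0 -> t \in `[0, 1] -> velocity gamma t w -> w = 0.
Proof.
move=> S1 tI vw.
have cst a b : 0 <= a -> a <= b -> b <= 1 -> gamma b = gamma a.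
  move=> a0 ab b1; apply/eqP; rewrite -subr_eq0 -normr_le0.
  apply: (le_trans (path_increment_norm Ag cg gS a0 ab b1)).
  have [_ S0 _] := gS.
  have := arc_length_mono Ag cg gS (le_trans a0 ab) b1 (lexx 1).
  have := arc_length_mono Ag cg gS (lexx 0) a0 (le_trans ab b1).
  by rewrite S1 S0; lra.
case: vw => [[t1 gw]|[t0 gw]].
  apply: (cvg_unique (@norm_hausdorff _ _) gw).
  apply: (@cvg_le0 _ _ _ _ _ _ _ (fun=> 0)); last exact: cvg_cst.
  apply: filterS (near_right tI t1) => u [u0 tp tu u1].
  by rewrite (cst _ _ tp tu u1) subrr scaler0 subrr normr0.
apply: (cvg_unique (@norm_hausdorff _ _) gw).
apply: (@cvg_le0 _ _ _ _ _ _ _ (fun=> 0)); last exact: cvg_cst.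
apply: filterS (near_left tI t0) => u [u0 ut tu t1].
by rewrite (cst _ _ ut tu t1) subrr scaler0 subrr normr0.
Qed.

Lemma binv_lipschitz (f g : blin V V) : Aut V f -> Aut V g ->
  `|binv f - binv g| <= `|f - g|.
Proof.
move=> Af Ag'.
have -> : binv f - binv g = bcomp (binv f) (bcomp (g - f) (binv g)).
  by rewrite bcompBl bcompBr (aut_inverse Ag').1 bcompf1 bcompA (aut_inverse Af).2 bcomp1f.
rewrite isometric_bcomp_norm; last exact/aut_isometric/autV.
by rewrite (distrC f) isometric_bcomp_normr//; exact/isometric_norm/aut_isometric/autV.
Qed.

Variables (D : der V) (phi : dual (der V)).
Hypothesis gD : bcomp (binv (gamma 0)) (gamma 1) = bexp D.
Hypothesis S1 : S 1 = `|D|.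
Hypothesis Dpi : `|D| < pi / 2.
Hypothesis phiD : norming D phi.

(** Apply [norming_increment] between [t] and a nearby point, and divide by the
    distance to this point. *)
Lemma norming_velocity (t : R) w (A : der V) : t \in `[0, 1] -> velocity gamma t w ->
  bcomp (binv (gamma t)) w = A -> phi A = `|A| :> R.
Proof.
move=> tI vw AE; apply/eqP; rewrite eq_le; apply/andP; split.
  apply: le_trans (ler_norm _) _; apply: (le_trans (ler_blin phi _)).
  by have [-> _] := phiD; rewrite mul1r.
have wE : w = bcomp (gamma t) A by rewrite -AE bcompA (aut_inverse (Ag tI)).1 bcomp1f.
have [D0|D0] := ltP 0 `|D|; last first.
  have w0 : w = 0.
    by apply: (velocity_eq0 _ tI vw); apply/eqP; rewrite S1 eq_le D0 normr_ge0.
  have -> : A = 0 by apply: val_inj; rewrite /= -AE w0 bcomp0r.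
  by rewrite blin0 normr0.
case: vw => [[t1 gw]|[t0 gw]].
  apply: (@norming_limit phi A (fun u => bcomp (binv (gamma t)) (u^-1 *: (gamma (u + t) - gamma t)))
    id 0^'+).
  - exact: cvg_trans at_right_dnbhs dnbhs_nbhs.
  - by rewrite -AE; apply: bcomp_cvg => //; exact: cvg_cst.
  - apply: filterS (near_right tI t1) => u [u0 tp tu u1]; split=> // Z.
    rewrite -bcompZr scalerA divff ?gt_eqF// scale1r bcompBr (aut_inverse (Ag tI)).2.
    exact: (norming_increment Ag cg gS gD S1 Dpi phiD).
apply: (@norming_limit phi A
  (fun u => bcomp (binv (gamma (u + t))) (u^-1 *: (gamma (u + t) - gamma t)))
  -%R 0^'-).
- have cN : (fun u : R => - u) @ 0^'- --> - (0 : R).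
    by apply: cvgN; exact: cvg_trans at_left_dnbhs dnbhs_nbhs.
  by rewrite oppr0 in cN.
- rewrite -AE; apply: bcomp_cvg => //.
  have gt : gamma (u + t) @[u --> 0^'-] --> gamma t by exact: quotient_cvg0 at_left_dnbhs gw.
  apply: (@cvg_le0 _ _ _ _ _ _ _ (fun u => `|gamma (u + t) - gamma t|)).
    apply: filterS (near_left tI t0) => u [u0 ut tu t1].
    by apply: binv_lipschitz; [apply: Ag; rewrite I01// (le_trans tu)|exact: Ag].
  by apply/norm_cvg0P/subr_cvg0.
- apply: filterS (near_left tI t0) => u [u0 ut tu t1]; rewrite oppr_gt0; split=> // Z.
  have uI : u + t \in `[0, 1] by rewrite I01// (le_trans tu).
  rewrite -bcompZr scalerA mulNr divff ?lt_eqF// scaleN1r opprB bcompBr.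
  rewrite (aut_inverse (Ag uI)).2.
  exact: (norming_increment Ag cg gS gD S1 Dpi phiD).
Qed.

End FaceVelocity.

(** * Injectivity of the exponential *)

(** At the midpoint the angle of [h] exceeds [r / 2], and it moves at speed at most
    [r] over a time at most [1 / 2]. *)
Lemma positive_of_rate {R : realType} (h h' : R -> R) (r : R) : 0 <= r -> r < pi ->
  (forall t : R, is_derive t 1 h (h' t)) -> (forall t, `|h t| < 1) ->
  (forall t, h' t ^+ 2 <= r ^+ 2 * (1 - h t ^+ 2)) -> sin (r / 2) < h 2^-1 ->
  forall t, 0 <= t -> t <= 1 -> 0 < h t.
Proof.
move=> r0 rpi dh h1 rate hr t t0 t1; rewrite ltNge; apply/negP => ht.
have pi0 := pi_gt0 R.
have hI u : -1 <= h u <= 1 by rewrite -ler_norml ltW.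
have contR (F F' : R -> R) a c : (forall t : R, is_derive t 1 F (F' t)) ->
    {within `[a, c], continuous F}.
  by move=> dF; apply: derivable_within_continuous => u _; have [] := dF u.
have dlin (u : R) : is_derive u 1 (fun u : R => r * u) r.
  by apply: is_derive_eq; rewrite /GRing.scale/= mulr1.
have [th|/ltW th] := leP t 2^-1.
  have H : asin (h 2^-1) - asin (h t) <= r * 2^-1 - r * t.
    apply: (@asin_rate_le _ [::] h (fun u => r * u)) => //.
    - exact: contR dh.
    - exact: contR dlin.
    by move=> u _ _; exists (h' u), r; split.
  have H2 : r / 2 < asin (h 2^-1).
    rewrite -ltr_sin ?in_itv/= ?asin_geNpi2 ?asin_lepi2// ?asinK ?in_itv//=.
    by apply/andP; split; lra.
  have H3 : asin (h t) <= 0.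
    by apply: asin_le; rewrite ?sin0 ?hI//; apply/andP; split; lra.
  have : 0 <= r * t by rewrite mulr_ge0.
  lra.
pose k u : R := - h u.
have dk (u : R) : is_derive u 1 k (- h' u) by exact: is_deriveN.
have kI u : -1 <= k u <= 1 by rewrite -ler_norml normrN ltW.
have H : asin (k t) - asin (k 2^-1) <= r * t - r * 2^-1.
  apply: (@asin_rate_le _ [::] k (fun u => r * u)) => //.
  - exact: contR dk.
  - exact: contR dlin.
  - by move=> u _; rewrite /k normrN.
  move=> u _ _; exists (- h' u), r; split=> //.
  by rewrite /k !sqrrN; exact: rate.
have H2 : asin (k 2^-1) < - (r / 2).
  rewrite -ltr_sin ?in_itv/= ?asin_geNpi2 ?asin_lepi2// ?asinK ?in_itv//=.
    by rewrite sinN ltrN2.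
  by apply/andP; split; lra.
have H3 : 0 <= asin (k t).
  by apply: asin_ge; rewrite ?sin0 ?oppr_ge0//; apply/andP; split; lra.
have : r * t <= r by rewrite ler_piMr.
lra.
Qed.

Section ExpInjective.
Context {R : realType} {E : completeNormedModType R}.
Implicit Types (X Y T : blin E E).

Lemma conjugation_is_derive X Y T (t : R) :
  is_derive t 1 (fun t => bcomp (flow X t) (bcomp T (flow Y t)))
    (bcomp X (bcomp (flow X t) (bcomp T (flow Y t))) +
     bcomp (bcomp (flow X t) (bcomp T (flow Y t))) Y).
Proof.
have dT := bcomp_is_derive (is_derive_cst T t 1) (flow_is_derive Y t).
have := bcomp_is_derive (flow_is_derive X t) dT.
rewrite bcomp0l add0r => H; apply: (@is_derive_eq _ _ _ _ _ _ _ _ H).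
by rewrite -!bcompA (flow_comm Y).
Qed.

(** If [e^X = e^Y], the path [e^{tX} e^{-tY}] is closed, so that
    [g t = f (e^{tX} e^{-tY} x)] has a critical point by Rolle's theorem. But its
    derivative is [f (e^{tX} (X - Y) e^{-tY} x)], which does not vanish on [0, 1] when
    [f] and [x] almost norm the operator at the midpoint, by [positive_of_rate]. *)
Lemma exp_injective X Y : isometric_flow X -> isometric_flow (- X) ->
  isometric_flow Y -> isometric_flow (- Y) ->
  `|X| + `|Y| < pi -> bexp X = bexp Y -> X = Y.
Proof.
move=> iX iNX iY iNY.
set r := `|X| + `|Y| => rpi eXY; apply/eqP; rewrite -subr_eq0 -normr_le0 leNgt.
apply/negP => K0; set K := `|X - Y| in K0.
have r0 : 0 <= r by rewrite addr_ge0.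
have pi0 := pi_gt0 R.
pose T := K^-1 *: (X - Y).
pose U t := bcomp (flow X t) (bcomp T (flow (- Y) t)).
have dU (t : R) : is_derive t 1 U (bcomp X (U t) + bcomp (U t) (- Y)).
  exact: conjugation_is_derive.
have T1 : `|T| = 1.
  by rewrite normrZ gtr0_norm ?invr_gt0// mulVf// gt_eqF.
have U1 t : `|U t| <= 1.
  apply: (le_trans (bcomp_norm _ _)); rewrite -[leRHS]mulr1 ler_pM//.
  by apply: (le_trans (isometric_bcomp_normr _ (iNY t))); rewrite T1.
have TU : 1 <= `|U (2^-1)|.
  have TE : T = bcomp (flow (- X) 2^-1) (bcomp (U 2^-1) (flow Y 2^-1)).
    rewrite /U -(bcompA (flow X _)) -(bcompA T) flowVK bcompf1.
    by rewrite (bcompA (flow (- X) _)) flowVK bcomp1f.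
  suff : `|T| <= `|U 2^-1| by rewrite T1.
  rewrite [in leLHS]TE.
  apply: (le_trans (bcomp_norm _ _)); rewrite -[leRHS]mul1r ler_pM//.
  exact: (isometric_bcomp_normr (U 2^-1) (iY 2^-1)).
have sr1 : sin (r / 2) < 1.
  have : sin (r / 2) < sin (pi / 2).
    by rewrite ltr_sin ?in_itv/=; [lra|apply/andP; split; lra..].
  by rewrite sin_pihalf.
have [f [x [f1 x1 fU]]] := exists_almost_norming (lt_le_trans sr1 TU).
pose h t : R := f (U t x).
have dh (t : R) : is_derive t 1 h (f (X (U t x)) + f (U t ((- Y) x))).
  have := blin_is_derive f (blin_eval_is_derive x (dU t)).
  by rewrite blinDE blinD.
have rate t : (f (X (U t x)) + f (U t ((- Y) x))) ^+ 2 <= r ^+ 2 * (1 - h t ^+ 2).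
  apply: flow_rate => //; last exact: ltW.
  by rewrite normrN.
have h1 t : `|h t| < 1.
  by rewrite (le_lt_trans (ler_blin1 f _))//; exact: le_trans (ler_blin1 _ x1) (U1 t).
have hpos := positive_of_rate r0 rpi dh h1 rate fU.
pose g t : R := f (flow X t (flow (- Y) t x)).
have dg (t : R) : is_derive t 1 g (K * h t).
  have := blin_is_derive f (blin_eval_is_derive x (conjugation_is_derive X (- Y) (bid E) t)).
  rewrite !bcomp1f => H; apply: (@is_derive_eq _ _ _ _ _ _ _ _ H).
  have KT : X - Y = K *: T by rewrite /T scalerA divff ?gt_eqF// scale1r.
  rewrite bcompA -flow_comm -!bcompA -bcompDr flow_comm.
  rewrite -bcompDl KT.
  by rewrite bcompZl bcompZr blinZE blinZ.
have g01 : g 0 = g 1.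
  rewrite /g !flow0 !bidE -[flow X 1 _]/(bcomp (flow X 1) (flow (- Y) 1) x).
  have -> : flow X 1 = flow Y 1 by rewrite /flow !scale1r.
  by rewrite flowKV.
have [||c c01 [_ dc]] := Rolle ltr01 _ _ g01.
- by move=> t _; have [] := dg t.
- by apply: derivable_within_continuous => t _; have [] := dg t.
have [_ dc'] := dg c; move: dc; rewrite dc' => /eqP.
rewrite mulf_eq0 (gt_eqF K0)/= => /eqP hc.
by move: c01; rewrite in_itv/= => /andP[/ltW c0 /ltW c1]; have := hpos c c0 c1; rewrite hc ltxx.
Qed.

End ExpInjective.

(** * Geodesics *)

Section ExpPath.
Context {R : realType} {V : jbAlgebraType R}.
Implicit Types (k : blin V V) (X : der V) (gamma : R -> blin V V).

Lemma exp_path_is_derive k X (t : R) :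
  is_derive t 1 (exp_path k X) (bcomp (exp_path k X t) X).
Proof.
have := bcomp_is_derive (is_derive_cst k t 1) (flow_is_derive X t).
by rewrite bcomp0l add0r -flow_comm bcompA.
Qed.

Lemma exp_path_derive1 k X : derive1 (exp_path k X) = fun t => bcomp (exp_path k X t) X.
Proof. by apply/funext => t; rewrite derive1E; have [] := exp_path_is_derive k X t. Qed.

Lemma exp_path_aut k X t : Aut V k -> Aut V (exp_path k X t).
Proof. by move=> Ak; apply: aut_comp => //; exact: flow_aut. Qed.

Lemma exp_path_continuous k X : continuous (exp_path k X).
Proof. by move=> t; exact: is_derive1_cont (exp_path_is_derive k X t). Qed.

Lemma exp_path0 k X : exp_path k X 0 = k.
Proof. by rewrite /exp_path scale0r bexp0 bcompf1. Qed.

Lemma exp_path1 k X : exp_path k X 1 = bcomp k (bexp X).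
Proof. by rewrite /exp_path scale1r. Qed.

Lemma exp_path_geodesic k X : Aut V k -> geodesic (exp_path k X).
Proof.
move=> Ak; split.
- by apply: continuous_subspaceT; exact: exp_path_continuous.
- by move=> t _; exact: exp_path_aut.
move=> t _; split.
- by have [] := exp_path_is_derive k X t.
- by exists X; rewrite exp_path_derive1.
have At : Aut V (exp_path k X t) by exact: exp_path_aut.
have DE : bcomp (binv (exp_path k X t)) (bcomp (exp_path k X t) X) = X.
  by rewrite bcompA (aut_inverse At).2 bcomp1f.
rewrite exp_path_derive1 /spray DE bcompA.
have := bcomp_is_derive (exp_path_is_derive k X t) (is_derive_cst (X : blin V V) t 1).
by rewrite bcomp0r addr0.
Qed.

Lemma exp_path_piecewise k X gamma : (forall t : R, t \in `[0, 1] -> gamma t = exp_path k X t) ->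
  piecewise_C1 gamma.
Proof.
move=> gE; have cg : {within `[0, 1], continuous gamma}.
  apply: (@subspace_eq_continuous _ _ _ (exp_path k X : subspace `[0, 1] -> blin V V)
    (gamma : subspace `[0, 1] -> blin V V)).
    by move=> t /set_mem tI; rewrite -gE.
  by apply: continuous_subspaceT; exact: exp_path_continuous.
split=> //; exists [:: 1]; first exact: itv_partition1 ltr01.
case=> // _ /=; exists (fun t => bcomp (exp_path k X t) X).
  apply: continuous_subspaceT => t; apply: bcomp_cvg; last exact: cvg_cst.
  exact: exp_path_continuous.
move=> t t01; apply: (near_eq_is_derive _ (exp_path_is_derive k X t)) => //.
apply: filterS (near_in_itvoo t01) => u; rewrite in_itv/= => /andP[/ltW u0 /ltW u1].
by rewrite gE// in_itv/= u0.
Qed.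

(** Both [S t - c t] and its opposite are nonincreasing. *)
Lemma arc_length_const gamma S s (c : R) : arc_length S s gamma ->
  (forall t : R, t \in `]0, 1[ -> t \notin s -> `|derive1 gamma t| = c) -> S 1 = c.
Proof.
move=> [cS S0 dS] gc.
have dc (t : R) : is_derive t 1 (fun t : R => c * t) c.
  by apply: is_derive_eq; rewrite /GRing.scale/= mulr1.
have cc : {within `[0, 1], continuous (fun t : R => c * t)}.
  by apply: derivable_within_continuous => t _; have [] := dc t.
have le1 : S 1 - c * 1 <= S 0 - c * 0.
  apply: (@le_of_derive_off_finite _ s (fun t => S t - c * t)) => //.
    by move=> t; apply: cvgB; [exact: cS|exact: cc].
  move=> t t01 ts; exists (`|derive1 gamma t| - c); last by rewrite gc// subrr.
  by apply: is_deriveB; have [] := dS t t01 ts.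
have le2 : c * 1 - S 1 <= c * 0 - S 0.
  apply: (@le_of_derive_off_finite _ s (fun t => c * t - S t)) => //.
    by move=> t; apply: cvgB; [exact: cc|exact: cS].
  move=> t t01 ts; exists (c - `|derive1 gamma t|); last by rewrite gc// subrr.
  by apply: is_deriveB; have [] := dS t t01 ts.
by apply/eqP; rewrite eq_le; move: le1 le2; rewrite S0; lra.
Qed.

(** Only the values of [gamma] on the unit interval are prescribed, so that its
    derivative is known in the interior only. *)
Lemma exp_path_length k X gamma : Aut V k ->
  (forall t : R, t \in `[0, 1] -> gamma t = exp_path k X t) -> Length gamma = `|X|%:E.
Proof.
move=> Ak gE.
have Ag (t : R) : t \in `[0, 1] -> Aut V (gamma t) by move=> /gE ->; exact: exp_path_aut.
have [S [s [gS ->]]] := Aut_path_arc_length Ag (exp_path_piecewise gE).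
congr EFin; apply: (arc_length_const gS) => t t01 _.
have -> : derive1 gamma t = bcomp (exp_path k X t) X.
  have dg : is_derive t 1 gamma (bcomp (exp_path k X t) X).
    apply: (near_eq_is_derive _ (exp_path_is_derive k X t)) => //.
    apply: filterS (near_in_itvoo t01) => u; rewrite in_itv/= => /andP[/ltW u0 /ltW u1].
    by rewrite gE// in_itv/= u0.
  by rewrite derive1E; have [] := dg.
by rewrite isometric_bcomp_norm//; exact/aut_isometric/exp_path_aut.
Qed.

Lemma binv_is_derive gamma (t : R) w : Aut V (gamma t) ->
  (\forall u \near 0^', Aut V (gamma (u + t))) -> is_derive t 1 gamma w ->
  is_derive t 1 (fun t => binv (gamma t))
    (- bcomp (binv (gamma t)) (bcomp w (binv (gamma t)))).
Proof.
move=> At Ag dg; have gt := shift_cvg (is_derive1_cont dg).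
move/is_derive1P: dg => gw; apply/is_derive1P.
have igt : binv (gamma (u + t)) @[u --> 0^'] --> binv (gamma t).
  apply: (@cvg_le0 _ _ _ _ _ _ _ (fun u => `|gamma (u + t) - gamma t|)).
    by apply: filterS Ag => u Au; exact: binv_lipschitz.
  by apply/norm_cvg0P/subr_cvg0.
have cv : - bcomp (binv (gamma (u + t)))
    (bcomp (u^-1 *: (gamma (u + t) - gamma t)) (binv (gamma t))) @[u --> 0^'] -->
    - bcomp (binv (gamma t)) (bcomp w (binv (gamma t))).
  apply: cvgN; apply: bcomp_cvg => //; apply: bcomp_cvg => //; exact: cvg_cst.
apply: cvg_trans cv; apply: near_eq_cvg; apply: filterS Ag => u Au.
rewrite bcompZl bcompZr -scalerN; congr (_ *: _).
rewrite bcompBl (aut_inverse At).1 bcompBr bcompf1 bcompA (aut_inverse Au).2 bcomp1f.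
by rewrite opprB.
Qed.

(** By the geodesic equation the derivative of [gamma^-1 gamma'] is
    [- A A + A A = 0], so this velocity is a constant [X] and [gamma e^{-tX}] is
    constant. *)
Lemma geodesic_exp gamma : geodesic gamma ->
  exists X, forall t : R, t \in `[0, 1] -> gamma t = exp_path (gamma 0) X t.
Proof.
move=> [cg Ag gg].
have sub (t : R) : t \in `]0, 1[ -> t \in `[0, 1].
  by rewrite !in_itv/= => /andP[/ltW -> /ltW ->].
have dg (t : R) : t \in `]0, 1[ -> is_derive t 1 gamma (derive1 gamma t).
  move=> t01; have [dgt _ _] := gg t t01.
  exact: (DeriveDef dgt (esym (derive1E _ _))).
pose A t := bcomp (binv (gamma t)) (derive1 gamma t).
have dA (t : R) : t \in `]0, 1[ -> is_derive t 1 A 0.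
  move=> t01; have [_ _ ddg] := gg t t01.
  have At := Ag t (sub t t01).
  have di := binv_is_derive At (near_path_Aut Ag t01) (dg t t01).
  have := bcomp_is_derive di ddg => H; apply: (@is_derive_eq _ _ _ _ _ _ _ _ H).
  rewrite /spray (bcompA (binv (gamma t)) (gamma t)) (aut_inverse At).2 bcomp1f.
  rewrite -[X in bcomp X _]scaleN1r bcompZl scaleN1r -!bcompA.
  by rewrite addNr.
have h01 : (2^-1 : R) \in `]0, 1[ by rewrite in_itv/= invr_gt0 ltr0n invf_lt1 ?ltr1n.
have [X XE] : exists X : der V, A 2^-1 = X.
  have [_ [X XE] _] := gg _ h01; exists X.
  by rewrite /A XE bcompA (aut_inverse (Ag _ (sub _ h01))).2 bcomp1f.
have AX (t : R) : t \in `]0, 1[ -> A t = X.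
  have cst (a b : R) : 0 < a -> a <= b -> b < 1 -> A a = A b.
    move=> a0 ab b1.
    have uI u : a <= u -> u <= b -> u \in `]0, 1[.
      by move=> ua ub; rewrite in_itv/= (lt_le_trans a0 ua) (le_lt_trans ub b1).
    have dAab (u : R) : u \in `]a, b[ -> is_derive u 1 A 0.
      by rewrite in_itv/= => /andP[/ltW ua /ltW ub]; exact: dA _ (uI u ua ub).
    have cAab : {within `[a, b], continuous A}.
      apply: derivable_within_continuous => u; rewrite in_itv/= => /andP[ua ub].
      by have [] := dA u (uI u ua ub).
    exact: (@is_derive0_cst _ _ A a b ab dAab cAab).
  move: h01; rewrite !in_itv/= => /andP[h0 h1] /andP[t0 t1].
  by rewrite -XE; have [th|/ltW th] := leP t 2^-1; [apply: cst|rewrite (cst 2^-1 t)].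
exists X => t; rewrite in_itv/= => /andP[t0 t1].
pose F t := bcomp (gamma t) (flow (- (X : blin V V)) t).
have dF (u : R) : u \in `]0, 1[ -> is_derive u 1 F 0.
  move=> u01; have uE : derive1 gamma u = bcomp (gamma u) X.
    by rewrite -(AX u u01) /A bcompA (aut_inverse (Ag u (sub u u01))).1 bcomp1f.
  have := bcomp_is_derive (dg u u01) (flow_is_derive (- (X : blin V V)) u).
  move=> H; apply: (@is_derive_eq _ _ _ _ _ _ _ _ H).
  by rewrite uE -bcompA -bcompDr -bcompDl subrr bcomp0l bcomp0r.
have dF0t (u : R) : u \in `]0, t[ -> is_derive u 1 F 0.
  rewrite in_itv/= => /andP[u0 ut]; apply: dF.
  by rewrite in_itv/= u0 (lt_le_trans ut).
have cF0t : {within `[0, t], continuous F}.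
  move=> u; apply: bcomp_cvg; first exact: (sub_itv_cont (lexx 0) t1 cg).
  apply: (@continuous_subspaceT _ _ _ (flow (- (X : blin V V)))) => v.
  exact: is_derive1_cont (flow_is_derive _ v).
have : F 0 = F t by exact: (@is_derive0_cst _ _ F 0 t t0 dF0t cF0t).
rewrite /F flow0 bcompf1 => ->.
by rewrite /exp_path -/(flow X t) -bcompA flowVK bcompf1.
Qed.

End ExpPath.

(** * Minimality *)

(** [path_angle] bounds the angle from [1] to [e^D] by the length of the path, and
    [exp_angle_ge] bounds it below by [|D|]. *)
Lemma Aut_path_length_ge (R : realType) (V : jbAlgebraType R) (k : blin V V) (D : der V)
    gamma : `|D| < pi / 2 -> Aut_path k (bcomp k (bexp D)) gamma ->
  (`|D|%:E <= Length gamma)%E.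
Proof.
move=> Dpi [Ag pg g0 g1]; have [cg _] := pg.
have [S [s [gS ->]]] := Aut_path_arc_length Ag pg; rewrite lee_fin.
apply: exp_angle_ge => //; first exact: der_isometric_flow.
have zI : (0 : R) \in `[0, 1] by rewrite in_itv/= lexx ler01.
have := path_increment_angle Ag cg gS (lexx 0) ler01 (lexx 1).
have [_ -> _] := gS; rewrite subr0 g0 g1.
by rewrite bcompA (aut_inverse _).2 ?bcomp1f// -g0; exact: Ag.
Qed.

Theorem theorem5p3 (R : realType) (V : jbAlgebraType R)
    (k : blin V V) (D : der V) (hk : Aut V k) (hD : `|D| < pi / 2) :
  let delta := exp_path k D in
  let l := bcomp k (bexp D) in
  [/\ (* delta is a geodesic in Aut(V) joining k and k e^D, and is minimizing *)
      geodesic delta /\ Aut_path k l delta,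
      dist_Aut k l = `|D|%:E,
      Length delta = `|D|%:E,
      (* the velocities of a short path stay in the face (in the cone over the
         face, if the path is not parametrized with constant speed) *)
      forall gamma, Aut_path k l gamma -> Length gamma = `|D|%:E ->
        forall phi : dual (der V), norming D phi ->
        (forall (t : R) w, t \in `[0, 1] -> velocity gamma t w ->
           exists c : R, exists2 X : der V, 0 <= c /\ face phi `|D| X
             & bcomp (binv (gamma t)) w = c *: X) /\
        (constant_speed gamma ->
         forall (t : R) w, t \in `[0, 1] -> velocity gamma t w ->
           exists2 X : der V, face phi `|D| X
             & bcomp (binv (gamma t)) w = X)
    & (* if the norm is smooth at D, then delta is the only short geodesic *)
      smooth_at D ->
      forall gamma, geodesic gamma -> gamma 0 = k -> gamma 1 = l ->
        Length gamma = `|D|%:E ->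
        forall t : R, t \in `[0, 1] -> gamma t = delta t ].
Proof.
move=> delta l.
have delta_path : Aut_path k l delta.
  split; [by move=> t _; exact: exp_path_aut| |exact: exp_path0|exact: exp_path1].
  exact: (@exp_path_piecewise _ _ k D).
have delta_length : Length delta = `|D|%:E by exact: (@exp_path_length _ _ k D).
split=> //.
- by split=> //; exact: exp_path_geodesic.
- apply/eqP; rewrite eq_le; apply/andP; split.
    by apply: ereal_inf_lbound; exists delta.
  by apply: le_ereal_inf_tmp => _ [gamma gk <-]; exact: Aut_path_length_ge gk.
- move=> gamma [Ag pg g0 g1] gL phi phiD; have [cg _] := pg.
  have [S [s [gS SL]]] := Aut_path_arc_length Ag pg.
  have S1 : S 1 = `|D| by move: gL; rewrite SL => -[].
  have gD : bcomp (binv (gamma 0)) (gamma 1) = bexp D.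
    by rewrite g0 g1 bcompA (aut_inverse hk).2 bcomp1f.
  have norming_vel := norming_velocity Ag cg gS gD S1 hD phiD.
  have [phi1 phiDE] := phiD.
  split.
    move=> t w tI vw; have [A AE] := velocity_der Ag tI vw.
    have phiA := norming_vel t w A tI vw AE.
    have [D0|D0] := eqVneq `|D| 0.
      exists 0; exists D; first by split=> //; split=> //; rewrite phiDE.
      by rewrite (velocity_eq0 Ag cg gS _ tI vw) ?S1// bcomp0r scale0r.
    have D_gt0 : 0 < `|D| by rewrite lt_def D0 normr_ge0.
    have [A0|A0] := eqVneq A 0.
      by exists 0; exists D => //; rewrite AE A0 scale0r.
    have nA : 0 < `|A| by rewrite normr_gt0.
    exists (`|A| / `|D|); exists ((`|D| / `|A|) *: A).
      split; first by rewrite divr_ge0.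
      split; first by rewrite normrZ ger0_norm ?divr_ge0// divfK// gt_eqF.
      by rewrite blinZ phiA -[_ *: _]/(_ * _) divfK// gt_eqF.
    rewrite -[RHS]/(`|A| / `|D| *: (`|D| / `|A| *: (A : blin V V))) scalerA.
    rewrite AE (_ : `|A| / `|D| * (`|D| / `|A|) = 1) ?scale1r//.
    by field; rewrite D0 gt_eqF.
  move=> [c gc] t w tI vw; have [A AE] := velocity_der Ag tI vw.
  have phiA := norming_vel t w A tI vw AE.
  have vA : `|A| = c by rewrite -(gc t w tI vw) /finsler AE.
  have c1 : S 1 = c.
    apply: (arc_length_const gS) => u u01 us; have [_ _ dS] := gS.
    have [dg _] := dS u u01 us.
    move: (u01); rewrite in_itv/= => /andP[u0 u1].
    have uI : u \in `[0, 1] by rewrite in_itv/= !ltW.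
    rewrite -(gc u (derive1 gamma u) uI).
      by rewrite /finsler isometric_bcomp_norm//; exact/aut_isometric/autV/Ag.
    left; split=> //; have gu := (is_derive1P _ _ _).1 dg.
    by move=> P /gu; exact: at_right_dnbhs.
  exists A => //; split; first by rewrite vA -c1.
  by rewrite phiA vA -c1.
- move=> _ gamma gg g0 g1 gL.
  have [X gX] := geodesic_exp gg; rewrite g0 in gX.
  have XD : `|X| = `|D|.
    by move: gL; rewrite (exp_path_length hk gX) => -[].
  suff DX : D = X by move=> t tI; rewrite gX// /delta DX.
  have eXD : bexp D = bexp X.
    have oI : (1 : R) \in `[0, 1] by rewrite in_itv/= lexx ler01.
    have := gX 1 oI; rewrite g1 exp_path1 /l => H.
    rewrite -(bcomp1f (bexp D)) -(bcomp1f (bexp X)) -(aut_inverse hk).2.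
    by rewrite -!bcompA H.
  apply: val_inj; apply: exp_injective eXD.
  - exact: der_isometric_flow.
  - exact: (der_isometric_flow (- D)).
  - exact: der_isometric_flow.
  - exact: (der_isometric_flow (- X)).
  - by rewrite -!der_norm_op XD; move: hD; lra.
Qed.
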